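(* Let $d\ge 1$ and let $\mu$ be a positive, bounded Radon measure on $\mathbb{R}^d$, with total mass $M>0$, supported in the cube $Q$ centered at the origin with edge size $L>0$. Let $\alpha\in[0,1]$ satisfy $\alpha>1-\frac1d$. Let $f:\mathbb{R}_+\to\mathbb{R}_+$ be continuous on $[0,+\infty)$, twice continuously differentiable for $z>0$, with $f(0)=0$, $f'(z)>0$ and $f''(z)\le 0$ for all $z>0$, and suppose that $$\limsup_{z\to 0^+} z^{-\beta} f(z)<+\infty$$ for some $\beta$ with $1-\frac1d<\beta<1$. Then the weighted irrigation cost of $\mu$ (with respect to $f$ and $\alpha$) is finite: $\mathcal{I}^{W,\alpha}(\mu)<+\infty$.
   Context: Here $\mathbb{R}_+=[0,+\infty)$. **Irrigation plans.** Let $\mu$ be a positive Radon measure on $\mathbb{R}^d$ with $\mu(\mathbb{R}^d)=M<\infty$ and let $\Theta=[0,M]$ (with Lebesgue measure $\mathrm{meas}$). An irrigation plan for $\mu$ is a function $\chi:\Theta\times\mathbb{R}_+\to\mathbb{R}^d$, measurable in $\theta$ and continuous in $t$, such that: (i) $\chi(\theta,0)=0$ for all $\theta$; (ii) for a.e. $\theta$ the map $t\mapsto\chi(\theta,t)$ is 1-Lipschitz and constant for $t$ large; $\tau(\theta)$ denotes the smallest time $\tau$ such that $\chi(\theta,\cdot)$ is constant for $t\ge\tau$; (iii) for each Borel set $V\subseteq\mathbb{R}^d$, $\mu(V)=\mathrm{meas}(\{\theta\in\Theta:\chi(\theta,\tau(\theta))\in V\})$. **Multiplicity.** Two 1-Lipschitz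 maps $\gamma:[0,t]\to\mathbb{R}^d$, $\tilde\gamma:[0,\tilde t]\to\mathbb{R}^d$ are equivalent, $\gamma\simeq\tilde\gamma$, if their arc-length re-parametrizations coincide. Write $(\theta,t)\sim(\theta',t')$ if $\chi(\theta,\cdot)|_{[0,t]}\simeq\chi(\theta',\cdot)|_{[0,t']}$, and put $m(\theta,t)=\mathrm{meas}(\{\theta'\in\Theta:(\theta',t')\sim(\theta,t)\text{ for some }t'>0\})$. Condition (A2) on $\chi$: for a.e. $\theta\in\Theta$, $m(\theta,t)>0$ for every $0\le t<\tau(\theta)$. **Weights on finitely many branches.** Consider a finite rooted family of branches $\gamma_i:[a_i,b_i]\to\mathbb{R}^d$, $i=1,\dots,N$, parametrized by arc-length and oriented from the root to the tips, with left-continuous non-increasing fluxes $m_i:[a_i,b_i]\to\mathbb{R}_+$. Let $\mathcal{O}(i)$ be the set of indices $j$ of branches that originate at the end node $\gamma_i(b_i)$ of $\gamma_i$. The weights $W_i$ are defined by backward induction (first the branches with $\mathcal{O}(i)=\emptyset$, then those all of whose successors have been treated, and so on): $W_i$ is the solution $\omega$ of $$\omega(t)=\int_t^{b_i} f(\omega(s))\,ds+m_i(t)+\overline\omega_i,\quad t\in(a_i,b_i],\qquad \overline\omega_i=\sum_{j\in\mathcal{O}(i)}W_j(a_j^+)-\sum_{j\in\mathcal{O}(i)}m_j(a_j^+)$$ (so $\overline\omega_i=0$ if $\mathcal{O}(i)=\emptyset$). **Weight of an irrigation plan.** Let $\chi$ be an irrigation plan satisfying (A2) and $\varepsilon>0$.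 A path $\gamma:[0,\ell]\to\mathbb{R}^d$ parametrized by arc-length is $\varepsilon$-good if $\mathrm{meas}(\{\theta:\chi(\theta,\cdot)|_{[0,t]}\simeq\gamma\text{ for some }t>0\})\ge\varepsilon$. Order paths by $\gamma\preceq\tilde\gamma$ if $\tilde\gamma$ extends $\gamma$. There are finitely many maximal $\varepsilon$-good paths $\hat\gamma_1,\dots,\hat\gamma_\nu$, $\hat\gamma_i:[0,\hat\ell_i]\to\mathbb{R}^d$, with fluxes $\hat m_i(s)=\mathrm{meas}(\{\theta:\exists t\ge0,\ \chi(\theta,\cdot)|_{[0,t]}\simeq\hat\gamma_i|_{[0,s]}\})$. Let $\tau_{ij}=\max\{t\ge 0:\hat\gamma_i(s)=\hat\gamma_j(s)\ \forall s\in[0,t]\}$. Each $\hat\gamma_i$ is split at the times $\tau_{ij}$ into elementary branches (restrictions to the consecutive subintervals, the last ending at $\hat\ell_i$), with flux the restriction of $\hat m_i$; pieces common to several maximal paths are listed only once. This gives a finite rooted tree of branches (branch $j$ follows branch $i$ when it begins where $i$ ends along a maximal path), on which weights are defined by backward induction from the tips to the root: writing the elementary branches as $\gamma_k:[a_k,b_k]\to\mathbb{R}^d$ with fluxes $m_k$, and $\mathcal{O}(k)$ for the set of indices of the branches that follow branch $k$, the weight $W_k$ is the solution $\omega$ of $\omega(t)=\int_t^{b_k}f(\omega(s))\,ds+m_k(t)+\overline\omega_k$, $t\in(a_k,b_k]$, with $\overline\omega_k=\sum_{j\in\mathcal{O}(k)}W_j(a_j^+)-\sum_{j\in\mathcal{O}(k)}m_j(a_j^+)$;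 let $\hat W_i:[0,\hat\ell_i]\to\mathbb{R}_+$ be the resulting weight along $\hat\gamma_i$. Let $\tau_\varepsilon(\theta)=\max\{t\ge0:m(\theta,t)\ge\varepsilon\}$. Set $W^\varepsilon(\theta,t)=\hat W_i(s)$ if $t\le\tau_\varepsilon(\theta)$ and $\chi(\theta,\cdot)|_{[0,t]}\simeq\hat\gamma_i|_{[0,s]}$, and $W^\varepsilon(\theta,t)=0$ if $t>\tau_\varepsilon(\theta)$. The weight function of $\chi$ is $W(\theta,t)=\sup_{\varepsilon>0}W^\varepsilon(\theta,t)$. **Weighted cost.** For $\alpha\in[0,1]$, $$\mathcal{E}^{W,\alpha}(\chi)=\int_0^M\int_0^{\tau(\theta)}\frac{(W(\theta,t))^\alpha}{m(\theta,t)}\,|\dot\chi(\theta,t)|\,dt\,d\theta,\qquad \mathcal{I}^{W,\alpha}(\mu)=\inf_\chi\mathcal{E}^{W,\alpha}(\chi),$$ the infimum being over all irrigation plans $\chi$ for $\mu$ satisfying (A2) (plans violating (A2) are regarded as having infinite cost; the infimum over the empty set is $+\infty$). *)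

(* Defs.v *)
From HB Require Import structures.
From mathcomp Require Import all_boot all_order all_algebra.
From mathcomp Require Import all_classical all_reals all_analysis.

Set Implicit Arguments.
Unset Strict Implicit.
Unset Printing Implicit Defensive.

Import Order.TTheory GRing.Theory Num.Theory.
Import numFieldNormedType.Exports.

Local Open Scope classical_set_scope.
Local Open Scope ring_scope.

Definition borel_rV (R : realType) (d : nat) :=
  g_sigma_algebraType (@open 'rV[R]_d).

(* Domain of [completed_lebesgue_measure]: R with the Lebesgue-measurable
   sets, as opposed to the Borel sets of [measurableTypeR R]. *)
Definition lebesgueTypeR (R : realType) :=
  caratheodory_type ((@wlength R idfun)^*)%mu.

Definition cube (R : realType) (d : nat) (L : R) : set 'rV[R]_d :=
  [set x | forall i, `|x ord0 i| <= L / 2].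

(* The library norm on ['rV[R]_d] is the sup norm. *)
Definition enorm (R : realType) (d : nat) (v : 'rV[R]_d) : R :=
  Num.sqrt (\sum_(i < d) v ord0 i ^+ 2).

Section curves.
Context {R : realType} {d : nat}.
Implicit Types (g : R -> 'rV[R]_d) (s t : R).

Definition arclen g t : R :=
  (\int[lebesgue_measure]_(s in `[0, t]) enorm (derive1 g s))%R.

Definition arc_reparam g s : 'rV[R]_d :=
  g (inf [set r | 0 <= r /\ arclen g r = s]).

(* [g] restricted to [0, t] and [g'] restricted to [0, t'] have the same
   arc-length re-parametrization (same length included). *)
Definition same_curve g t g' t' : Prop :=
  arclen g t = arclen g' t' /\
  forall s, 0 <= s <= arclen g t -> arc_reparam g s = arc_reparam g' s.

Definition arclen_param (l : R) g : Prop :=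
  (forall s t, 0 <= s <= l -> 0 <= t <= l ->
     enorm (g t - g s) <= `|t - s|) /\
  (forall s, 0 <= s <= l -> arclen g s = s).

End curves.

Section irrigation_plans.
Context {R : realType} {d : nat}.
Implicit Types (M : R) (chi : R -> R -> 'rV[R]_d) (theta t : R).

Definition stop_time chi theta : R :=
  inf [set T | 0 <= T /\ forall t, T <= t -> chi theta t = chi theta T].

(* Only the values [chi theta t] with [0 <= theta <= M] and [0 <= t] matter. *)
Record irrigation_plan (mu : set (borel_rV R d) -> \bar R) M chi : Prop :=
  IrrigationPlan {
    plan_measurable : forall t, 0 <= t ->
      @measurable_fun _ _ (lebesgueTypeR R) (borel_rV R d)
        `[0, M] (fun theta => chi theta t) ;
    plan_continuous : forall theta, 0 <= theta <= M ->
      {within `[0, +oo[, continuous (chi theta)} ;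
    plan_origin : forall theta, 0 <= theta <= M -> chi theta 0 = 0 ;
    plan_lipschitz : {ae completed_lebesgue_measure, forall theta,
      0 <= theta <= M ->
      (forall s t, 0 <= s -> 0 <= t ->
         enorm (chi theta t - chi theta s) <= `|t - s|) /\
      (exists T, 0 <= T /\ forall t, T <= t -> chi theta t = chi theta T)} ;
    plan_irrigates : forall V : set (borel_rV R d), measurable V ->
      mu V = completed_lebesgue_measure
        [set theta | 0 <= theta <= M /\ V (chi theta (stop_time chi theta))]
  }.

Definition multiplicity M chi theta t : R :=
  fine (completed_lebesgue_measure [set theta' | 0 <= theta' <= M /\
    exists t', 0 < t' /\ same_curve (chi theta') t' (chi theta) t]).

Definition A2 M chi : Prop :=
  {ae completed_lebesgue_measure, forall theta, 0 <= theta <= M ->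
    forall t, 0 <= t < stop_time chi theta -> 0 < multiplicity M chi theta t}.

End irrigation_plans.

(* A path on [0, len]; [initial] makes [crv] constant on either side of the
   interval, so that paths with the same values on it are Leibniz-equal. *)
Record rpath (R : realType) (d : nat) :=
  Path { len : R ; crv : R -> 'rV[R]_d }.

Definition initial (R : realType) (d : nat) (p : rpath R d) (l : R) :=
  Path l (fun s => crv p (Num.max 0 (Num.min s l))).

Definition extends (R : realType) (d : nat) (q p : rpath R d) : Prop :=
  len p <= len q /\ forall s, 0 <= s <= len p -> crv p s = crv q s.

(* The elementary branch that is the restriction of a maximal path p to [a, b]
   is encoded by [a] and by the initial portion of p on [0, b]: pieces of two
   maximal paths are the same branch iff these paths agree up to [b]. *)
Record branch (R : realType) (d : nat) :=
  Branch { lo : R ; stem : rpath R d }.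

Definition hi (R : realType) (d : nat) (k : branch R d) : R := len (stem k).

HB.instance Definition _ (R : realType) (d : nat) := gen_eqMixin (branch R d).
HB.instance Definition _ (R : realType) (d : nat) :=
  gen_choiceMixin (branch R d).

Section weights.
Context {R : realType} {d : nat}.
Variables (f : R -> R) (M : R) (chi : R -> R -> 'rV[R]_d).
Implicit Types (p q : rpath R d) (k j : branch R d) (s t a b : R).

Definition flux p s : R :=
  fine (completed_lebesgue_measure [set theta | 0 <= theta <= M /\
    exists t, 0 <= t /\ same_curve (chi theta) t (crv p) s]).

Definition branch_flux k : R -> R := flux (stem k).

Definition weight_eq a b (m : R -> R) (wbar : R) (w : R -> R) : Prop :=
  forall t, a < t <= b ->
    [/\ 0 <= w t,
        lebesgue_measure.-integrable `[t, b] (EFin \o (f \o w)) &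
        w t = (\int[lebesgue_measure]_(s in `[t, b]) f (w s))%R + m t + wbar].

Definition right_lim (w : R -> R) a : R := lim (w t @[t --> a^'+]).

Definition excess (O : set (branch R d)) (W : branch R d -> R -> R) : R :=
  \sum_(j \in O) right_lim (W j) (lo j) -
  \sum_(j \in O) right_lim (branch_flux j) (lo j).

Section epsilon.
Variable eps : R.

Definition good p : Prop :=
  [/\ 0 <= len p, p = initial p (len p), arclen_param (len p) (crv p) &
      (eps%:E <= completed_lebesgue_measure [set theta | (0 <= theta <= M)%R /\
         exists t, (0 < t)%R /\
           same_curve (chi theta) t (crv p) (len p)])%E].

Definition maximal_good p : Prop :=
  good p /\ forall q, good q -> extends q p -> q = p.

Definition split_time p q : R :=
  sup [set t | [/\ 0 <= t, t <= len p, t <= len q &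
    forall s, 0 <= s <= t -> crv p s = crv q s]].

Definition nodes p : set R :=
  [set 0; len p] `|`
  [set split_time p q | q in [set q | maximal_good q /\ q <> p]].

Definition consecutive p a b : Prop :=
  [/\ nodes p a, nodes p b, a < b & forall c, nodes p c -> ~ (a < c < b)].

Definition piece p a b : branch R d := Branch a (initial p b).

Definition followers k : set (branch R d) :=
  [set j | exists p a b c, [/\ maximal_good p, consecutive p a b,
     consecutive p b c, k = piece p a b & j = piece p b c]].

Definition root_branches : set (branch R d) :=
  [set j | exists p b, [/\ maximal_good p, consecutive p 0 b &
     j = piece p 0 b]].

(* Backward induction from the tips. *)
Inductive is_weight (k : branch R d) (w : R -> R) : Prop :=
  IsWeight (W : branch R d -> R -> R) :
    (forall j, followers k j -> is_weight j (W j)) ->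
    weight_eq (lo k) (hi k) (branch_flux k) (excess (followers k) W) w ->
    is_weight k w.

(* Unique up to its values off (lo k, hi k]. *)
Definition branch_weight k : R -> R := xget (fun=> 0) (is_weight k).

(* [w] is the weight along the maximal path [p] at arc-length [s]. At the root
   [s = 0], which belongs to no (a, b], we use the same balance as at the end
   node of a branch. *)
Definition path_weight p s (w : R) : Prop :=
  (s = 0 /\ w = flux p 0 + excess root_branches branch_weight) \/
  (exists a b, [/\ consecutive p a b, a < s <= b &
     w = branch_weight (piece p a b) s]).

(* +oo if [theta] keeps multiplicity at least [eps] forever, -oo if it never
   has it. *)
Definition tau_eps theta : \bar R :=
  ereal_sup [set t%:E | t in
    [set t | 0 <= t /\ eps <= multiplicity M chi theta t]].

Definition weight_eps theta t : R :=
  if (t%:E <= tau_eps theta)%E then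
    xget 0 [set w | exists p s, [/\ maximal_good p, 0 <= s <= len p,
      same_curve (chi theta) t (crv p) s & path_weight p s w]]
  else 0.

End epsilon.

Definition weight theta t : \bar R :=
  ereal_sup [set (weight_eps eps theta t)%:E | eps in [set eps | 0 < eps]].

Definition plan_cost (alpha : R) : \bar R :=
  (\int[completed_lebesgue_measure]_(theta in (`[0%R, M] : set R))
     \int[lebesgue_measure]_(t in `[0%R, stop_time chi theta])
       (weight theta t `^ alpha *
        ((multiplicity M chi theta t)^-1 * enorm (derive1 (chi theta) t))%R%:E))%E.

End weights.

Definition irrigation_cost (R : realType) (d : nat) (f : R -> R) (alpha : R)
    (mu : set (borel_rV R d) -> \bar R) : \bar R :=
  let M := fine (mu setT) in
  ereal_inf [set plan_cost f M chi alpha | chi in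
    [set chi | irrigation_plan mu M chi /\ A2 M chi]].

(* Main.v *)
Require Import Defs.
From mathcomp Require Import all_boot all_order all_algebra.
From mathcomp Require Import all_classical all_reals all_analysis.
From mathcomp Require Import measurable_realfun ring lra zify.
Set Implicit Arguments.
Unset Strict Implicit.
Unset Printing Implicit Defensive.
Import Order.TTheory GRing.Theory Num.Theory.
Import numFieldNormedType.Exports.
Local Open Scope classical_set_scope.
Local Open Scope ring_scope.

(** A single irrigation plan of finite cost is exhibited. Let D be the dimension.

    Geometry. Cut space by bisections along the coordinate axes in turn. The
    cells of level n are indexed by words of n bits, and the mass of a word is the
    measure mu of its cell. The interval [0, M] is cut in the same way into
    intervals of these masses ([cylinder_interval]), so that each particle theta
    has an infinite sequence of bits. It travels at unit speed, after a delay,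
    along the broken line that visits the centers of its cells; the n-th edge has
    length L rho^n with rho = 2^(-1/D), and the total length is finite. The end
    points of the lines have law mu, because open sets are exhausted by cells and
    the cells have the right masses ([arrival_law]). Two particles follow each
    other exactly as long as their bits agree, so the multiplicity of theta on its
    n-th edge is the mass of its word of n + 1 bits ([multiplicity_plan]).

    The weights. The growth condition on f and its concavity give, with
    lam n = 2^(-n), the affine bound f z <= c n * (z + lam n), where
    c n = kappa * 2^(n (1 - beta)) ([f_affine]). As beta > 1 - 1/D, the products
    of c n by the length of an edge of level n form a geometric series of ratio
    less than 1; let E n be the exponential of twice its tail from n on. The key
    estimate, valid for every eps, is
      W + lam n <= E n * (m + lam n)
    for the weight W and the flux m at a point of level n
    ([is_weight_bounded]). It is proved by backward induction over the branches.
    Inside a branch it is Gronwall's inequality for the weight minus the flux. At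
    a node the bounds on the followers have to be added: a branch has at most two
    followers, one for each value of the next bit ([follower_unique]); their
    masses sum to at most the mass of the cell, and their shifts lam (n + 1) sum
    to lam n ([excess_le]). The shift makes up for the lack of a Lipschitz
    condition on f at 0; its total over the cells of a level is bounded, as
    the total mass is.

    The cost. On level n the integrand is at most a constant times
    lam n^(alpha - 1) * (1 + lam n / m), since alpha <= 1. Its
    integral over theta is at most a constant times lam n^(alpha - 1), since there
    are 2^(n + 1) cells. The cost is thus bounded by the series of the
    terms rho^n * 2^(n (1 - alpha)), which converges because
    alpha > 1 - 1/D ([plan_cost_le]). *)

(** * Integrals of functions that need not be measurable *)

Section nonmeasurable_integrands.
Context d (T : measurableType d) (R : realType).
Variable mu : {measure set T -> \bar R}.
Local Open Scope ereal_scope.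

(** The integral of a nonnegative function is a supremum over the simple
    functions below it, hence is monotone whether or not the integrands are
    measurable. *)
Lemma ge0_le_integral_nm (D : set T) (f g : T -> \bar R) :
  (forall x, D x -> 0 <= f x) -> (forall x, D x -> f x <= g x) ->
  \int[mu]_(x in D) f x <= \int[mu]_(x in D) g x.
Proof.
move=> f0 fg.
have g0 x : D x -> 0 <= g x by move=> Dx; exact: le_trans (f0 x Dx) (fg x Dx).
rewrite !ge0_integralE//; apply: ereal_sup_le => _ [h /= hf <-].
exists h => //= x; apply: le_trans (hf x) _.
by rewrite /patch; case: ifPn => // /set_mem; exact: fg.
Qed.

(** With c = +oo the integrand on the left dominates every function that is at
    most g off the null set N, measurable or not. *)
Lemma integral_change_null (D N : set T) (c : \bar R) (g : T -> \bar R) :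
  measurable D -> measurable N -> mu N = 0 -> 0 <= c ->
  (forall x, D x -> 0 <= g x) -> measurable_fun D g ->
  \int[mu]_(x in D) (if x \in N then c else g x) = \int[mu]_(x in D) g x.
Proof.
move=> mD mN N0 c0 g0 mg.
apply: ge0_ae_eq_integral => //.
- apply: measurable_fun_if => //; last exact: measurable_funS mg.
  apply: (measurable_fun_bool true).
  rewrite [X in measurable (_ `&` X)](_ : _ = N); first exact: measurableI.
  by apply/seteqP; split => x /= => [/set_mem|/mem_set].
- by move=> x Dx; case: ifP => // _; exact: g0.
- exists N; split => // x /= /not_implyP[Dx].
  by apply: contra_notP => nN; rewrite ifF//; apply/negbTE; rewrite notin_setE.
Qed.

Lemma ge0_le_integral_off (D N : set T) (f g : T -> \bar R) :
  measurable D -> measurable N -> mu N = 0 ->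
  (forall x, D x -> 0 <= f x) -> (forall x, D x -> 0 <= g x) ->
  measurable_fun D g ->
  (forall x, D x -> ~ N x -> f x <= g x) ->
  \int[mu]_(x in D) f x <= \int[mu]_(x in D) g x.
Proof.
move=> mD mN N0 f0 g0 mg fg.
rewrite -(integral_change_null mD mN N0 (leey 0) g0 mg).
apply: ge0_le_integral_nm => // x Dx; case: ifPn => [_|]; first exact: leey.
by rewrite notin_setE; exact: fg.
Qed.

Lemma ge0_eq_integral_off (D N : set T) (f g : T -> \bar R) :
  measurable D -> measurable N -> mu N = 0 ->
  (forall x, D x -> 0 <= f x) -> (forall x, D x -> 0 <= g x) ->
  measurable_fun D g ->
  (forall x, D x -> ~ N x -> f x = g x) ->
  \int[mu]_(x in D) f x = \int[mu]_(x in D) g x.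
Proof.
move=> mD mN N0 f0 g0 mg fg; apply/eqP; rewrite eq_le; apply/andP; split.
  by apply: (ge0_le_integral_off mD mN) => // x Dx nN; rewrite fg.
rewrite -(integral_change_null mD mN N0 (lexx 0) g0 mg).
apply: ge0_le_integral_nm => x Dx.
  by case: ifP => // _; exact: g0.
by case: ifPn => [_|]; [exact: f0|rewrite notin_setE => nN; rewrite fg].
Qed.

End nonmeasurable_integrands.

(** * Coding of an interval by a mass on the binary tree *)

Section coding.
Context {R : realType}.
Variable M : R.
Variable mass : seq bool -> R.
Hypothesis mass_ge0 : forall w, 0 <= mass w.
Hypothesis mass_nil : mass [::] = M.
Hypothesis massD : forall w, mass (rcons w false) + mass (rcons w true) = mass w.

(** The word read by a point theta after n bisections, together with the offset
    of theta in the interval of that word: the interval of a word w, of length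
    mass w, is cut into those of w0 and w1, in this order. *)
Fixpoint code_state (theta : R) (n : nat) : seq bool * R :=
  if n is n'.+1 then
    let: (w, r) := code_state theta n' in
    if r < mass (rcons w false) then (rcons w false, r)
    else (rcons w true, r - mass (rcons w false))
  else ([::], theta).

Definition code (theta : R) (n : nat) : bool :=
  last false (code_state theta n.+1).1.

Definition word (theta : R) (n : nat) : seq bool := mkseq (code theta) n.

Lemma code_stateS theta n :
  code_state theta n.+1 = let: (w, r) := code_state theta n in
    if r < mass (rcons w false) then (rcons w false, r)
    else (rcons w true, r - mass (rcons w false)).
Proof. by []. Qed.

Lemma code_stateE theta n : (code_state theta n).1 = word theta n.
Proof.
elim: n => // n IH; rewrite /word mkseqS -/(word theta n) -IH /code.
rewrite code_stateS.
by case: (code_state theta n) => w r; case: ifP => /= _; rewrite last_rcons.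
Qed.

Lemma wordS theta n : word theta n.+1 = rcons (word theta n) (code theta n).
Proof. by rewrite /word mkseqS. Qed.

Lemma size_word theta n : size (word theta n) = n.
Proof. by rewrite /word size_mkseq. Qed.

Lemma mass_rcons w b : mass (rcons w b) <= mass w.
Proof.
have := massD w; have := mass_ge0 (rcons w false).
by have := mass_ge0 (rcons w true); case: b; lra.
Qed.

Lemma mass_word_le theta m n : (m <= n)%N -> mass (word theta n) <= mass (word theta m).
Proof.
move=> /subnK <-; elim: (n - m)%N => //= k IH.
by rewrite addSn wordS; apply: le_trans (mass_rcons _ _) IH.
Qed.

(** The intervals are half-open, so none of them contains the right end M, although
    M too has words. *)
Lemma cylinder_interval w : exists c : R, 0 <= c /\ c + mass w <= M /\
  forall theta, 0 <= theta < M ->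
    (word theta (size w) = w <-> c <= theta < c + mass w) /\
    (word theta (size w) = w -> (code_state theta (size w)).2 = theta - c).
Proof.
elim/last_ind: w => [|w b [c [c0 [cM IH]]]].
  exists 0; rewrite mass_nil add0r; split => //; split => // theta t0M.
  by split => //=; rewrite subr0.
have [c' c'E] : exists c', c' = if b then c + mass (rcons w false) else c by eexists.
have D := massD w; have m0 := mass_ge0 (rcons w false); have m1 := mass_ge0 (rcons w true).
exists c'; split; first by rewrite c'E; destruct b; lra.
split; first by rewrite c'E; destruct b; lra.
move=> theta t0M; have [IH1 IH2] := IH _ t0M.
rewrite size_rcons.
have -> : (word theta (size w).+1 = rcons w b) <->
    (word theta (size w) = w /\ code theta (size w) = b).
  rewrite wordS; split => [/rcons_inj[-> ->//]|[-> ->//]].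
have key : word theta (size w) = w ->
    code_state theta (size w).+1 =
    if theta - c < mass (rcons w false) then (rcons w false, theta - c)
    else (rcons w true, theta - c - mass (rcons w false)).
  move=> H; have E := code_stateE theta (size w); have := IH2 H.
  rewrite code_stateS; case: (code_state theta (size w)) E => /= w0 r -> ->.
  by rewrite H.
split.
- split.
  + move=> [H]; have /IH1 := H; have := key H; rewrite /code => ->.
    rewrite c'E; case: (ltP (theta - c) (mass (rcons w false))) => /= h; rewrite last_rcons => h1 hb; rewrite -hb; lra.
  + move=> H; have Hw : word theta (size w) = w.
      by apply/IH1; move: H; rewrite c'E; destruct b; lra.
    split => //; rewrite /code key//; move: H; rewrite c'E.
    by case: (ltP (theta - c) (mass (rcons w false))) => /= h; rewrite last_rcons; destruct b => //; lra.
- move=> [H]; rewrite /code key// c'E.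
  case: (ltP (theta - c) (mass (rcons w false))) => _ /=; rewrite last_rcons; destruct b => // _; lra.
Qed.

End coding.

(** A function of a word of fixed length is a finite combination of indicators
    of cylinders, so its integral is the corresponding finite sum. *)
Section words.
Context d (T : measurableType d) (R : realType).
Variable m : {measure set T -> \bar R}.
Variables (D : set T) (W : T -> seq bool) (n : nat).
Hypothesis mD : measurable D.
Hypothesis sizeW : forall x, D x -> size (W x) = n.
Hypothesis mW : forall w, measurable (D `&` [set x | W x = w]).
Local Open Scope ereal_scope.

Lemma word_tuple x : D x -> exists t : n.-tuple bool, tval t = W x.
Proof. by move=> /sizeW Wx; exists (tcast Wx (in_tuple (W x))); rewrite val_tcast. Qed.

Lemma measurable_words (P : set (seq bool)) : measurable (D `&` [set x | P (W x)]).
Proof.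
rewrite (_ : _ `&` _ = \big[setU/set0]_(t : n.-tuple bool | `[< P t >])
    (D `&` [set x | W x = t])).
  by apply: bigsetU_measurable => t _; exact: mW.
rewrite -bigcup_seq_cond; apply/seteqP; split => x /=.
- move=> [Dx Px]; have [t tW] := word_tuple Dx; exists t => /=; last by rewrite tW.
  by apply/andP; split; [exact: mem_index_enum|rewrite tW; apply/asboolP].
- by move=> [t /= /andP[_ /asboolP Pt] [Dx ->]].
Qed.

Lemma words_expand (G : seq bool -> R) x : D x ->
  (G (W x))%:E = \sum_(t : n.-tuple bool)
    (G t)%:E * (\1_(D `&` [set x | W x = t]) x)%:E.
Proof.
move=> Dx; have [u uW] := word_tuple Dx; rewrite (bigD1 u)//=.
rewrite big1 ?adde0 => [|t tu].
  by rewrite indicE mem_set ?mule1 ?uW.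
rewrite indicE memNset ?mule0// => -[_ /= Wt].
by case/eqP: tu; apply/val_inj; rewrite /= uW Wt.
Qed.

Lemma measurable_fun_words (G : seq bool -> R) :
  measurable_fun D (fun x => (G (W x))%:E).
Proof.
apply: (eq_measurable_fun (fun x => \sum_(t : n.-tuple bool)
    (G t)%:E * (\1_(D `&` [set x | W x = t]) x)%:E)).
  by move=> x /[!inE] Dx; rewrite -words_expand.
apply: emeasurable_sum => t; apply: emeasurable_funM; first exact: measurable_cst.
by apply/measurable_EFinP; apply: measurable_indic; exact: mW.
Qed.

Lemma integral_words (G : seq bool -> R) : (forall w, 0 <= G w)%R ->
  \int[m]_(x in D) (G (W x))%:E =
  \sum_(t : n.-tuple bool) (G t)%:E * m (D `&` [set x | W x = t]).
Proof.
move=> G0; under eq_integral => x /[!inE] Dx do rewrite words_expand//.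
rewrite ge0_integral_sum//.
- apply: eq_bigr => t _; rewrite ge0_integralZl_EFin//.
  + by rewrite (integral_indic _ mD (mW t)) setIC setIA setIid.
  + by apply/measurable_EFinP; apply: measurable_indic; exact: mW.
- move=> t; apply: emeasurable_funM; first exact: measurable_cst.
  by apply/measurable_EFinP; apply: measurable_indic; exact: mW.
- by move=> t x _; rewrite mule_ge0// lee_fin.
Qed.

Lemma measure_words (P : set (seq bool)) :
  m (D `&` [set x | P (W x)]) =
  \sum_(t : n.-tuple bool) (`[< P t >]%:R : R)%:E * m (D `&` [set x | W x = t]).
Proof.
rewrite -(integral_words (fun w => ler0n R `[< P w >])).
have mDP := measurable_words P.
rewrite (_ : D `&` [set x | P (W x)] = D `&` [set x | P (W x)] `&` D); last first.
  by rewrite setIAC setIid.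
rewrite -(integral_indic _ mD mDP).
apply: eq_integral => x /[!inE] Dx; rewrite indicE; congr ((nat_of_bool _)%:R%:E).
by apply/idP/idP => [/set_mem[_ /asboolP]//|/asboolP Px]; apply/mem_set.
Qed.

End words.

Section coding_measure.
Context {R : realType}.
Variables (M : R) (mass : seq bool -> R).
Hypothesis mass_ge0 : forall w, 0 <= mass w.
Hypothesis mass_nil : mass [::] = M.
Hypothesis massD : forall w, mass (rcons w false) + mass (rcons w true) = mass w.

Let dom : set R := [set theta | 0 <= theta <= M].

Lemma dom_measurable : @measurable _ (lebesgueTypeR R) dom.
Proof.
apply: sub_caratheodory; rewrite (_ : dom = `[0, M]%classic); first exact: measurable_itv.
by apply/seteqP; split => x; rewrite /= in_itv.
Qed.

Lemma cylinder_measurable_measure w :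
  @measurable _ (lebesgueTypeR R) (dom `&` [set theta | word mass theta (size w) = w]) /\
  completed_lebesgue_measure (dom `&` [set theta | word mass theta (size w) = w])
    = (mass w)%:E.
Proof.
have [c [c0 [cM H]]] := cylinder_interval mass_ge0 mass_nil massD w.
set S := _ `&` _.
pose T := S `&` [set M].
have ST : S = `[c, c + mass w[%classic `|` T.
  apply/seteqP; split => [x [/= /andP[x0 xM] Wx]|x [/=|[]//]].
    have [xltM|Mx] := ltP x M.
      left; rewrite /= in_itv/=; apply/(proj1 (H x _)) => //.
      by rewrite x0.
    have xE : x = M by apply/eqP; rewrite eq_le xM Mx.
    right; by split => //; split => //; rewrite /dom /= x0 xM.
  rewrite /= ?in_itv/= => /andP[cx xc].
  have x0M : 0 <= x < M by rewrite (le_trans c0 cx) (lt_le_trans xc).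
  split; first by rewrite /dom /=; case/andP: x0M => -> /ltW ->.
  by apply/(proj1 (H x x0M)); rewrite cx xc.
have mT : @measurable _ (measurableTypeR R) T /\ (lebesgue_measure : set R -> \bar R) T = 0%E.
  have [SM|nSM] := pselect (S M).
    have -> : T = [set M] by apply/seteqP; split => [x []//|x ->].
    by split => //; exact: lebesgue_measure_set1.
  have -> : T = set0 by apply/seteqP; split => [x [Sx /= xM]|//]; apply: nSM; rewrite -xM.
  by split => //; exact: measure0.
have mS : @measurable _ (measurableTypeR R) S.
  by rewrite ST; apply: measurableU => //; exact: mT.1.
split; first exact: sub_caratheodory.
transitivity (lebesgue_measure `[c, (c + mass w)%R[ + (lebesgue_measure : set R -> \bar R) T)%E.
  rewrite -[LHS]/((lebesgue_measure : set R -> \bar R) S) ST.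
  apply: measureU; [exact: measurable_itv|exact: mT.1|].
  apply/seteqP; split => // x [/=]; rewrite in_itv/= => /andP[_ xc] [_ /= xM].
  by move: xc; rewrite xM ltNge cM.
rewrite mT.2 adde0 lebesgue_measure_itv/= lte_fin ltrDl.
case: ifPn => [_|]; first by rewrite -EFinB addrAC subrr add0r.
by rewrite -leNgt => h; congr EFin; apply/eqP; rewrite eq_le h mass_ge0.
Qed.

Lemma cylinder_measurable n w :
  @measurable _ (lebesgueTypeR R) (dom `&` [set theta | word mass theta n = w]).
Proof.
have [<-|nw] := eqVneq (size w) n; first exact: (cylinder_measurable_measure w).1.
rewrite (_ : _ `&` _ = set0); first exact: measurable0.
by apply/seteqP; split => // x [_ /= Ww]; case/eqP: nw; rewrite -Ww size_word.
Qed.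

Lemma cylinder_measure n w : size w = n ->
  completed_lebesgue_measure (dom `&` [set theta | word mass theta n = w])
    = (mass w)%:E.
Proof. by move=> <-; exact: (cylinder_measurable_measure w).2. Qed.

End coding_measure.

(** * Broken lines turning along the coordinate axes *)

(* Case analysis on the minima and maxima of the goal; the two orders serve the
   two ways in which minima and maxima are nested. *)
Ltac minmax_lra := first
  [ repeat match goal with
    | |- context [Num.max ?a ?b] => case: (leP a b) => ?
    | |- context [Num.min ?a ?b] => case: (leP a b) => ?
    end; lra
  | repeat match goal with
    | |- context [Num.min ?a ?b] => case: (leP a b) => ?
    | |- context [Num.max ?a ?b] => case: (leP a b) => ?
    end; lra ].

Section enorm_bounds.
Context {R : realType} {d : nat}.
Implicit Types u v : 'rV[R]_d.

Lemma sum_sqr_le (I : Type) (r : seq I) (F : I -> R) : (forall i, 0 <= F i) ->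
  \sum_(i <- r) F i ^+ 2 <= (\sum_(i <- r) F i) ^+ 2.
Proof.
move=> F0; elim: r => [|i r IH]; first by rewrite !big_nil expr0n.
rewrite !big_cons; have := F0 i.
have : 0 <= \sum_(j <- r) F j by apply: sumr_ge0.
move: IH; set a := F i; set S := \sum_(j <- r) F j => IH S0 a0.
have := mulr_ge0 a0 S0; nra.
Qed.

Lemma enorm_le_sum v : enorm v <= \sum_i `|v ord0 i|.
Proof.
rewrite /enorm -[leRHS]ger0_norm ?sumr_ge0// -sqrtr_sqr ler_sqrt ?sqr_ge0//.
rewrite (eq_bigr (fun i => `|v ord0 i| ^+ 2)); first exact: sum_sqr_le.
by move=> i _; rewrite real_normK ?num_real.
Qed.

Lemma coord_le_enorm v i : `|v ord0 i| <= enorm v.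
Proof.
rewrite /enorm -sqrtr_sqr ler_sqrt ?sumr_ge0//; last by move=> *; exact: sqr_ge0.
by rewrite (bigD1 i)//= lerDl sumr_ge0// => *; exact: sqr_ge0.
Qed.

Lemma enorm0 : enorm (0 : 'rV[R]_d) = 0.
Proof.
by rewrite /enorm big1 ?sqrtr0// => i _; rewrite mxE expr0n.
Qed.

Lemma enorm_delta (c : R) (i : 'I_d) : enorm (c *: delta_mx ord0 i) = `|c|.
Proof.
rewrite /enorm (bigD1 i)//= big1 ?addr0.
  by rewrite !mxE !eqxx mulr1 sqrtr_sqr.
by move=> j ji; rewrite !mxE (negbTE ji) andbF mulr0 expr0n.
Qed.

Lemma enormB u v : enorm (u - v) = enorm (v - u).
Proof.
by rewrite /enorm; congr Num.sqrt; apply: eq_bigr => i _; rewrite -opprB mxE sqrrN.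
Qed.

Lemma enorm_ge0 v : 0 <= enorm v.
Proof. exact: sqrtr_ge0. Qed.

Lemma norm_row_le v (c : R) : 0 <= c -> (forall i, `|v ord0 i| <= c) -> `|v| <= c.
Proof.
move=> c0 vc; rewrite /Num.norm /= mx_normrE.
apply: (big_ind (fun x => x <= c)) => //.
  by move=> x y hx hy; rewrite ge_max hx hy.
by move=> [i j] _ /=; rewrite (ord1 i).
Qed.

Lemma norm_le_enorm v : `|v| <= enorm v.
Proof. by apply: norm_row_le => [|i]; [exact: enorm_ge0|exact: coord_le_enorm]. Qed.

End enorm_bounds.

Section broken_line.
Context {R : realType}.
Variable d : nat.
Variables H rho : R.
Hypothesis H0 : 0 < H.
Hypothesis rho0 : 0 < rho.
Hypothesis rho1 : rho < 1.
Implicit Types (beta : nat -> bool) (s t : R) (m n : nat).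

Definition step m : R := H * rho ^+ m.
Definition total : R := H / (1 - rho).
(** The arc length at the start of the n-th edge: the sum of the first n steps, in
    closed form. *)
Definition node n : R := total * (1 - rho ^+ n).
Definition axis m : 'I_d.+1 := inord (m %% d.+1).
Definition sgb (b : bool) : R := if b then 1 else -1.

Definition covered m s : R := Num.min (step m) (Num.max 0 (s - node m)).

Definition term beta s (i : 'I_d.+1) : R^nat :=
  fun m => sgb (beta m) * covered m s * (axis m == i)%:R.

(** The m-th edge runs along the axis number m mod (d + 1), in the sense given by
    the m-th bit. The series is finite below the total length, but not at its
    end point, where all the edges have been covered. *)
Definition line beta s : 'rV[R]_d.+1 := \row_i limn (series (term beta s i)).

Lemma stepE m : step m = H * rho ^+ m.
Proof. by []. Qed.

Lemma totalE : total = H / (1 - rho).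
Proof. by []. Qed.

Lemma step_gt0 m : 0 < step m.
Proof. by rewrite /step mulr_gt0// exprn_gt0. Qed.

Lemma nodeS n : node n.+1 = node n + step n.
Proof.
by rewrite /node /step /total exprS; field; rewrite subr_eq0 gt_eqF.
Qed.

Lemma node0 : node 0 = 0.
Proof. by rewrite /node expr0 subrr mulr0. Qed.

Lemma total_gt0 : 0 < total.
Proof. by rewrite /total divr_gt0// subr_gt0. Qed.

Lemma node_lt_total n : node n < total.
Proof.
have := total_gt0; have : 0 < rho ^+ n by rewrite exprn_gt0.
rewrite /node; nra.
Qed.

Lemma node_le m n : (m <= n)%N -> node m <= node n.
Proof.
move=> /subnK <-; elim: (n - m)%N => //= k IH.
by rewrite addSn nodeS; have := step_gt0 (k + m)%N; lra.
Qed.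

Lemma node_ge0 n : 0 <= node n.
Proof. by rewrite -node0 node_le. Qed.

Lemma node_lt m n : (m < n)%N -> node m < node n.
Proof.
move=> /node_le; rewrite nodeS; have := step_gt0 m; lra.
Qed.

Lemma node_lt_inv m n : node m < node n -> (m < n)%N.
Proof. by rewrite ltnNge => h; apply/negP => /node_le; rewrite leNgt h. Qed.

Lemma total_sub_node n : total - node n = total * rho ^+ n.
Proof. by rewrite /node; ring. Qed.

Lemma node_exists s : 0 < s -> s < total -> exists n, node n < s <= node n.+1.
Proof.
move=> s0 sl.
have [N hN] : exists N, s <= node N.
  have /cvgr0Pnorm_lt/(_ ((total - s) / total)) : rho ^+ n @[n --> \oo] --> 0.
    by apply: cvg_expr; rewrite ger0_norm// ltW.
  have t0 := total_gt0.
  case; first by rewrite divr_gt0// subr_gt0.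
  move=> N _ /(_ N (leqnn N)); rewrite ger0_norm ?exprn_ge0 ?ltW//.
  rewrite ltr_pdivlMr// mulrC => h; exists N; rewrite /node; lra.
elim: N hN => [|N IH] hN; first by move: hN; rewrite node0; lra.
by have [/IH//|h] := leP s (node N); exists N; rewrite h hN.
Qed.

Lemma covered_ge0 m s : 0 <= covered m s.
Proof.
by rewrite /covered le_min le_max lexx /= andbT ltW// step_gt0.
Qed.

Lemma covered_le m s : covered m s <= step m.
Proof. by rewrite /covered ge_min lexx. Qed.

Lemma covered_mono m s t : s <= t -> covered m s <= covered m t.
Proof. by move=> st; rewrite /covered; have := step_gt0 m; minmax_lra. Qed.

Lemma covered0 m s : s <= node m -> covered m s = 0.
Proof. by move=> h; rewrite /covered; have := step_gt0 m; minmax_lra. Qed.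

Lemma covered_full m s : node m.+1 <= s -> covered m s = step m.
Proof. by rewrite nodeS => h; rewrite /covered; have := step_gt0 m; minmax_lra. Qed.

Lemma covered_mid m s : node m <= s <= node m.+1 -> covered m s = s - node m.
Proof. by rewrite nodeS => h; rewrite /covered; have := step_gt0 m; minmax_lra. Qed.

Lemma sum_covered n s :
  \sum_(0 <= m < n) covered m s = Num.min (node n) (Num.max 0 s).
Proof.
elim: n => [|n IH]; first by rewrite big_nil node0; minmax_lra.
rewrite big_nat_recr//= IH nodeS /covered.
by have := step_gt0 n; have := node_ge0 n; minmax_lra.
Qed.

Lemma term_le beta s i m : `|term beta s i m| <= step m.
Proof.
rewrite /term !normrM (ger0_norm (covered_ge0 _ _)).
have -> : `|sgb (beta m)| = 1 by rewrite /sgb; case: (beta m); rewrite ?normrN normr1.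
rewrite mul1r; have := covered_le m s; have := covered_ge0 m s.
by case: (axis m == i); rewrite ?normr1 ?normr0 ?mulr1 ?mulr0//; lra.
Qed.

Lemma term_cvg beta s i : cvgn (series (term beta s i)).
Proof.
apply: normed_cvg; apply: (@series_le_cvg _ _ (geometric H rho)).
- by move=> n; exact: normr_ge0.
- by move=> n; exact: ltW (step_gt0 n).
- by move=> n; exact: term_le.
- by apply: is_cvg_geometric_series; rewrite ger0_norm// ltW.
Qed.

Lemma lineE beta s n i : s <= node n -> line beta s ord0 i = series (term beta s i) n.
Proof.
move=> sn; rewrite /line mxE; apply: norm_lim_near_cst; near=> N.
have nN : (n <= N)%N by near: N; exists n.
rewrite /series/= (big_cat_nat _ nN)//= [X in _ + X]big_nat [X in _ + X]big1 ?addr0// => m.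
move=> /andP[nm _]; rewrite /term covered0 ?mulr0 ?mul0r//.
exact: le_trans sn (node_le nm).
Unshelve. all: by end_near. Qed.

Lemma eq_line beta beta' s n : s <= node n ->
  (forall m, (m < n)%N -> beta m = beta' m) -> line beta s = line beta' s.
Proof.
move=> sn bb; apply/rowP => i; rewrite !(lineE _ _ sn) /series/=.
by apply: eq_big_nat => m /andP[_ mn]; rewrite /term bb.
Qed.

Lemma line_le0 beta s : s <= 0 -> line beta s = 0.
Proof.
move=> s0; apply/rowP => i; rewrite (@lineE _ _ 0%N) ?node0// /series/=.
by rewrite big_nil mxE.
Qed.

Lemma line_edge beta n s : node n <= s <= node n.+1 ->
  line beta s = line beta (node n) + (sgb (beta n) * (s - node n)) *: delta_mx ord0 (axis n).
Proof.
move=> /andP[ns sn]; apply/rowP => i; rewrite [RHS]mxE (lineE _ _ sn) (lineE _ _ (lexx (node n))).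
rewrite [X in _ = _ + X]mxE [delta_mx _ _ _ _]mxE eqxx/=.
rewrite /series/= big_nat_recr//=; congr (_ + _).
  apply: eq_big_nat => m /andP[_ mn]; rewrite /term !covered_full//; first exact: node_le.
  by apply: le_trans ns; exact: node_le.
by rewrite /term covered_mid ?ns// eq_sym.
Qed.

Lemma line_ge_total beta s : total <= s -> line beta s = line beta total.
Proof.
move=> ls; apply/rowP => i; rewrite !mxE; congr (limn (series _)).
have h n : node n <= total by rewrite ltW// node_lt_total.
by apply/funext => m; rewrite /term !covered_full// (le_trans _ ls).
Qed.

(** Along each edge the line moves by the increment of the part covered, and these
    parts add up to the arc length. Passing through the partial sums includes the
    end point of the line. *)
Lemma line_lipschitz beta s t : enorm (line beta t - line beta s) <= `|t - s|.
Proof.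
wlog st : s t / s <= t.
  move=> Hw; have [/Hw//|ts] := leP s t; rewrite distrC.
  by rewrite enormB; exact: Hw (ltW ts).
apply: le_trans (enorm_le_sum _) _; rewrite ger0_norm ?subr_ge0//.
pose F N (i : 'I_d.+1) := `|series (term beta t i) N - series (term beta s i) N|.
have cF i : F N i @[N --> \oo] --> `|(line beta t - line beta s) ord0 i|.
  by rewrite !mxE; apply: cvg_norm; apply: cvgB; exact: term_cvg.
have cS : \sum_i F N i @[N --> \oo] --> \sum_i `|(line beta t - line beta s) ord0 i|.
  by apply: cvg_big => [|i _]; [exact: add_continuous|exact: cF].
rewrite -(cvg_lim _ cS)//; apply: limr_le; first by apply/cvg_ex; eexists; exact: cS.
near=> N; rewrite /F.
have E i : series (term beta t i) N - series (term beta s i) N =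
    \sum_(0 <= m < N) sgb (beta m) * (covered m t - covered m s) * (axis m == i)%:R.
  rewrite /series/= -sumrB; apply: eq_bigr => m _; rewrite /term; ring.
rewrite (le_trans (y := \sum_i \sum_(0 <= m < N) (covered m t - covered m s) * (axis m == i)%:R))//.
  apply: ler_sum => i _; rewrite E; apply: le_trans (ler_norm_sum _ _ _) _.
  apply: ler_sum => m _.
  have h : 0 <= covered m t - covered m s by rewrite subr_ge0; exact: covered_mono.
  rewrite !normrM (ger0_norm h).
  have -> : `|sgb (beta m)| = 1 by rewrite /sgb; case: (beta m); rewrite ?normrN normr1.
  by rewrite mul1r; case: (axis m == i); rewrite ?normr1 ?normr0.
rewrite exchange_big/= (eq_bigr (fun m => covered m t - covered m s)); last first.
  move=> m _; rewrite -mulr_sumr (bigD1 (axis m))//= eqxx big1 ?addr0 ?mulr1// => i.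
  by rewrite eq_sym => /negbTE ->.
rewrite sumrB !sum_covered; have := node_ge0 N; minmax_lra.
Unshelve. all: by end_near. Qed.

Lemma line_norm beta s t : `|line beta t - line beta s| <= `|t - s|.
Proof. exact: le_trans (norm_le_enorm _) (line_lipschitz _ _ _). Qed.

(** The displacement along an edge that has been entered shows the sense in which
    it is run through, hence its bit. *)
Lemma line_inj beta beta' n s : node n < s ->
  (forall r, 0 <= r <= s -> line beta r = line beta' r) ->
  forall m, (m <= n)%N -> beta m = beta' m.
Proof.
move=> ns E m; elim/ltn_ind: m => m IH mn.
have ms : node m < s by apply: le_lt_trans ns; exact: node_le.
have st := step_gt0 m.
have [r [r1 r2 r3]] : exists r, [/\ node m < r, r <= s & r <= node m.+1].
  exists (Num.min s (node m.+1)); rewrite nodeS; split; minmax_lra.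
have := E r; rewrite (line_edge beta (n := m)) ?r3 ?(ltW r1)//.
rewrite (line_edge beta' (n := m)) ?r3 ?(ltW r1)//.
rewrite (eq_line (lexx (node m)) (beta' := beta')); last first.
  by move=> k km; apply: IH => //; apply: leq_trans (ltnW km) mn.
move=> /(_ _)/addrI; rewrite r2 (le_trans (node_ge0 m) (ltW r1)) => /(_ isT).
move=> /rowP/(_ (axis m)); rewrite !mxE !eqxx !mulr1 /sgb.
by case: (beta m); case: (beta' m) => //; lra.
Qed.

(** The start of the edge that follows the edges coded by w; it serves as the
    center of the cell of w. *)
Definition center (w : seq bool) : 'rV[R]_d.+1 :=
  \row_i \sum_(0 <= m < size w) sgb (nth false w m) * step m * (axis m == i)%:R.

Lemma line_node beta n : line beta (node n) = center (mkseq beta n).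
Proof.
apply/rowP => i; rewrite (lineE _ _ (lexx _)) mxE size_mkseq /series/=.
apply: eq_big_nat => m /andP[_ mn]; rewrite /term covered_full ?nth_mkseq//.
exact: node_le.
Qed.

End broken_line.

(* From here on, lines are known through the lemmas above only. *)
#[global] Opaque line.

(** * Arc length of broken lines and of irrigating curves *)

Lemma derive1_locally_affine (R : realType) (d : nat) (g : R -> 'rV[R]_d) (r : R) v :
  (\forall h \near (0 : R), g (h + r) = g r + h *: v) -> derive1 g r = v.
Proof.
move=> E; rewrite /derive1; apply: norm_lim_near_cst; near=> h.
have h0 : h != 0 by near: h; exact: nbhs_dnbhs_neq.
have -> : g (h + r) = g r + h *: v by near: h; exact: nbhs_dnbhs.
by rewrite addrC addKr scalerA mulVf// scale1r.
Unshelve. all: by end_near. Qed.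

Lemma near0_lt (R : realType) (e : R) : 0 < e -> \forall h \near (0 : R), `|h| < e.
Proof.
by move=> e0; apply/nbhs_ballP; exists e => //= h; rewrite /ball/= sub0r normrN.
Qed.

Lemma inf_minimum (R : realType) (A : set R) x : A x -> lbound A x -> inf A = x.
Proof.
move=> Ax lx; apply/eqP; rewrite eq_le; apply/andP; split.
  by apply: ge_inf => //; exists x.
by apply: lb_le_inf => //; exists x.
Qed.

(** On an initial interval where arc length is already the parameter, the
    arc-length reparametrization changes nothing, whatever the curve does
    beyond. *)
Lemma arc_reparam_id (R : realType) (d : nat) (g : R -> 'rV[R]_d) (l s : R) :
  (forall r, 0 <= r <= l -> arclen g r = r) -> 0 <= s <= l -> arc_reparam g s = g s.
Proof.
move=> gl sl; rewrite /arc_reparam (@inf_minimum _ _ s)//.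
  by split; [case/andP: sl|exact: gl].
move=> r [r0 rs]; rewrite leNgt; apply/negP => rlts.
by move: rs; rewrite gl; [lra|move: sl; lra].
Qed.

Lemma countable_union T (A B : set T) : countable A -> countable B -> countable (A `|` B).
Proof.
move=> cA cB; rewrite (_ : _ `|` _ = \bigcup_(b in [set: bool]) (if b then A else B)).
  by apply: bigcup_countable => // -[].
apply/seteqP; split => [x [Ax|Bx]|x [[] _ ?]]; [by exists true|by exists false|by left|by right].
Qed.

Section curves_of_lines.
Context {R : realType}.
Variable d : nat.
Variables H rho : R.
Hypothesis H0 : 0 < H.
Hypothesis rho0 : 0 < rho.
Hypothesis rho1 : rho < 1.
Implicit Types (beta : nat -> bool) (s t r l : R) (n : nat).
Local Notation line := (line d H rho).
Local Notation node := (node H rho).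
Local Notation total := (total H rho).

Definition corners : set R := [set 0; total] `|` range node.

Lemma corners_countable : countable corners.
Proof.
apply: countable_union; first by apply: finite_set_countable; exact: finite_set2.
exact: card_image_le.
Qed.

Lemma not_corner s : 0 < s < total -> ~ corners s ->
  exists n, node n < s < node n.+1.
Proof.
move=> /andP[s0 sl] cs; have [n /andP[n1 n2]] := node_exists H0 rho0 rho1 s0 sl.
exists n; rewrite n1 /= lt_neqAle n2 andbT; apply/eqP => sn; apply: cs.
by right; exists n.+1.
Qed.

Lemma line_near beta s : 0 < s < total -> ~ corners s ->
  exists2 v, enorm v = 1 & \forall h \near (0 : R), line beta (h + s) = line beta s + h *: v.
Proof.
move=> sl cs; have [n /andP[n1 n2]] := not_corner sl cs.
exists (sgb (beta n) *: delta_mx ord0 (axis d n)).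
  by rewrite enorm_delta /sgb; case: ifP => _; rewrite ?normrN normr1.
have e0 : 0 < Num.min (s - node n) (node n.+1 - s).
  by rewrite lt_min; apply/andP; split; lra.
near=> h.
have : `|h| < Num.min (s - node n) (node n.+1 - s) by near: h; exact: near0_lt e0.
rewrite !lt_min => /andP[h1 h2].
have /andP[h5 h6] : - `|h| <= h <= `|h| by rewrite -ler_norml.
rewrite (line_edge d H0 rho0 rho1 beta (n := n)); last by apply/andP; split; lra.
rewrite (line_edge d H0 rho0 rho1 beta (n := n) (s := s)); last by apply/andP; split; lra.
by rewrite scalerA -[RHS]addrA -scalerDl; congr (_ + _ *: _); ring.
Unshelve. all: by end_near. Qed.

Lemma line_speed beta g s l :
  (forall r, 0 < r < l -> g r = line beta r) -> l <= total -> 0 < s < l ->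
  ~ corners s -> enorm (derive1 g s) = 1.
Proof.
move=> gE ltot sl cs; have /andP[s0 sltl] := sl.
have [|v v1 E] := @line_near beta s _ cs; first by rewrite s0 (lt_le_trans sltl).
rewrite (@derive1_locally_affine _ _ g s v)//.
have e0 : 0 < Num.min s (l - s) by rewrite lt_min s0 subr_gt0.
near=> h.
have : `|h| < Num.min s (l - s) by near: h; exact: near0_lt e0.
rewrite lt_min => /andP[h1 h2].
have /andP[h5 h6] : - `|h| <= h <= `|h| by rewrite -ler_norml.
rewrite !gE//; last by apply/andP; split; lra.
by near: h; exact: E.
Unshelve. all: by end_near. Qed.

Lemma countable_null (A : set R) : countable A ->
  measurable A /\ lebesgue_measure A = 0%E.
Proof.
by move=> cA; split; [exact: countable_measurable|exact: countable_lebesgue_measure0].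
Qed.

Lemma arclen_line beta g l s :
  (forall r, 0 < r < l -> g r = line beta r) -> l <= total -> 0 <= s <= l ->
  arclen g s = s.
Proof.
move=> gE ltot /andP[s0 sl].
have [mN N0] : measurable (corners `|` [set s]) /\ lebesgue_measure (corners `|` [set s]) = 0%E.
  by apply/countable_null/countable_union; [exact: corners_countable|exact: countable1].
rewrite /arclen /Rintegral.
rewrite (ge0_eq_integral_off (mu := lebesgue_measure) (g := cst 1%E) (measurable_itv _) mN N0)//.
- rewrite integral_cst//= mul1e lebesgue_measure_itv/= lte_fin.
  by case: ifPn => [_|]; rewrite ?oppr0 ?addr0//= -leNgt => ?; lra.
- by move=> r _; rewrite lee_fin enorm_ge0.
- move=> r /=; rewrite in_itv/= => /andP[r0 rs] /not_orP[cr rns].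
  have rs' : r < s by rewrite lt_neqAle rs andbT; apply/eqP.
  rewrite (line_speed gE ltot)//; rewrite (lt_le_trans rs' sl) andbT lt_neqAle r0 andbT.
  by apply/eqP => r00; apply: cr; left; left.
Qed.

(** The particle waits for one unit of time before it leaves. The multiplicity at
    time 0 counts the particles that have covered no length at some positive
    time; without a delay it would be zero, and (A2) would fail. *)
Definition delayed beta t := line beta (t - 1).

Definition travelled t := Num.max 0 (Num.min (t - 1) total).

Lemma travelledD1 s : 0 <= s <= total -> travelled (s + 1) = s.
Proof.
by move=> /andP[s0 sl]; rewrite /travelled addrK (min_idPl sl) (max_idPr s0).
Qed.

Lemma travelled_wait t : t <= 1 -> travelled t = 0.
Proof. by move=> t1; apply/max_idPl; rewrite ge_min subr_le0 t1. Qed.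

Lemma travelled_move t : 1 <= t <= 1 + total -> travelled t = t - 1.
Proof. by move=> t1; rewrite -[in LHS](subrK 1 t) travelledD1//; lra. Qed.

Lemma travelled_bounds t : 0 <= travelled t <= total.
Proof.
have t0 := total_gt0 H0 rho1.
by rewrite /travelled le_max lexx/= ge_max (ltW t0) ge_min lexx orbT.
Qed.

Lemma delayed_corners_null : measurable [set t | corners (t - 1)] /\
  lebesgue_measure [set t | corners (t - 1)] = 0%E.
Proof.
apply: countable_null; rewrite (_ : mkset _ = (fun r => r + 1) @` corners).
  by apply: (card_le_trans (card_image_le _ _)); exact: corners_countable.
apply/seteqP; split => [r /= cr|_ [r cr <-]]; last by rewrite /= addrK.
by exists (r - 1) => //; rewrite subrK.
Qed.

Lemma delayed_speed beta t : ~ corners (t - 1) ->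
  enorm (derive1 (delayed beta) t) = \1_(`]1, 1 + total[) t.
Proof.
move=> ct.
have nc0 : t - 1 != 0 by apply/eqP => h; apply: ct; left; left.
have ncl : t - 1 != total by apply/eqP => h; apply: ct; left; right.
have [t1|t1] := ltP t 1.
  rewrite indicE memNset ?(@derive1_locally_affine _ _ _ t 0) ?enorm0//; last first.
    by rewrite /= in_itv/=; lra.
  have e0 : 0 < 1 - t by rewrite subr_gt0.
  near=> h; rewrite scaler0 addr0 /delayed.
  have : `|h| < 1 - t by near: h; exact: near0_lt e0.
  by move=> h1; rewrite !line_le0//; have := ler_norm h; lra.
have [t2|t2] := ltP (t - 1) total.
  have t3 : 0 < t - 1 < total by rewrite t2 andbT lt_neqAle eq_sym nc0 subr_ge0.
  have [v v1 E] := @line_near beta _ t3 ct.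
  rewrite (@derive1_locally_affine _ _ _ t v)//.
    by rewrite indicE mem_set//= in_itv/=; lra.
  by near=> h; rewrite /delayed -addrA; near: h.
rewrite indicE memNset ?(@derive1_locally_affine _ _ _ t 0) ?enorm0//; last first.
  by rewrite /= in_itv/=; lra.
have t3 : total < t - 1 by rewrite lt_neqAle eq_sym ncl.
have e0 : 0 < t - 1 - total by rewrite subr_gt0.
near=> h; rewrite scaler0 addr0 /delayed.
have : `|h| < t - 1 - total by near: h; exact: near0_lt e0.
move=> h1; have := ler_norm (- h); rewrite normrN => h2.
by rewrite line_ge_total ?[RHS]line_ge_total//; lra.
Unshelve. all: by end_near. Qed.

Lemma arclen_delayed beta t : 0 <= t -> arclen (delayed beta) t = travelled t.
Proof.
move=> t0; have tot0 := total_gt0 H0 rho1.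
have [mN N0] := delayed_corners_null.
rewrite /arclen /Rintegral.
rewrite (ge0_eq_integral_off (mu := lebesgue_measure) (g := fun r => (\1_(`]1, 1 + total[) r)%:E) (measurable_itv _) mN N0)//.
- rewrite integral_indic// (_ : `]1, 1 + total[ `&` _ =
      if t - 1 < total then `]1, t]%classic else `]1, 1 + total[%classic).
    rewrite /travelled; have [tt|tt] := ltP (t - 1) total.
      rewrite -[fine _]/(fine (lebesgue_measure `]1, t]%classic)).
      rewrite lebesgue_measure_itv/= lte_fin; have [t1|t1] := ltP 1 t.
        by rewrite -EFinB/=; case: leP => //; lra.
      by rewrite /=; case: leP => //; lra.
    rewrite -[fine _]/(fine (lebesgue_measure `]1, 1 + total[%classic)).
    rewrite lebesgue_measure_itv/= lte_fin ifT ?ltrDl// -EFinB/= (max_idPr (ltW tot0)).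
    by rewrite addrAC subrr add0r.
  apply/seteqP; split => r /=; rewrite !in_itv/=.
    by case: ifPn => /= tt [/andP[r1 r2] /andP[r3 r4]]; rewrite in_itv/=; apply/andP.
  case: ifPn => /= tt; rewrite in_itv/= => /andP[r1 r2]; split; apply/andP; split; lra.
- by move=> r _; rewrite lee_fin enorm_ge0.
- by apply/measurable_EFinP; apply: measurable_indic.
- by move=> r _ cr; rewrite delayed_speed.
Qed.

Lemma delayed0 beta t : t <= 1 -> delayed beta t = 0.
Proof. by move=> t1; rewrite /delayed line_le0// subr_le0. Qed.

Lemma delayed_lipschitz beta s t : enorm (delayed beta t - delayed beta s) <= `|t - s|.
Proof.
apply: le_trans (line_lipschitz _ H0 rho0 rho1 _ _ _) _.
by rewrite (_ : t - 1 - (s - 1) = t - s)//; ring.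
Qed.

Lemma delayed_continuous beta : continuous (delayed beta).
Proof.
move=> s; apply/cvgrPdist_le => /= e e0; near=> t.
apply: le_trans (norm_le_enorm _) _; apply: le_trans (delayed_lipschitz _ _ _) _.
by near: t; apply: cvgr_dist_le => //; exact: cvg_id.
Unshelve. all: by end_near. Qed.

Lemma arc_reparam_delayed beta s : 0 <= s <= total ->
  arc_reparam (delayed beta) s = line beta s.
Proof.
move=> /andP[s0 sl]; rewrite /arc_reparam; move: s0; rewrite le_eqVlt => /orP[/eqP<-|s0].
  rewrite (@inf_minimum _ _ 0); last 2 first.
  - split => //; rewrite arclen_delayed// /travelled sub0r.
    by have := total_gt0 H0 rho1; minmax_lra.
  - by move=> r [].
  by rewrite delayed0// line_le0.
rewrite (@inf_minimum _ _ (s + 1)).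
- by rewrite /delayed addrK.
- by split; [lra|rewrite arclen_delayed ?travelledD1 ?(ltW s0) ?sl//; lra].
- move=> r [r0]; rewrite arclen_delayed// /travelled.
  minmax_lra.
Qed.

(** Both curves coincide with their arc-length reparametrizations, up to the
    delay. *)
Lemma same_curve_delayed beta t (g : R -> 'rV[R]_d.+1) l s : 0 <= t ->
  (forall r, 0 <= r <= l -> arclen g r = r) -> 0 <= s <= l ->
  same_curve (delayed beta) t g s <->
  travelled t = s /\ forall r, 0 <= r <= s -> line beta r = g r.
Proof.
move=> t0 gl sl; rewrite /same_curve arclen_delayed// gl//.
have /andP[_ tt] := travelled_bounds t.
split => -[ts E]; split => // r rs.
- rewrite -(arc_reparam_id gl) -?E ?ts ?arc_reparam_delayed//; move: rs sl tt; rewrite ts; lra.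
- move: rs; rewrite ts => rs; rewrite (arc_reparam_id gl) ?arc_reparam_delayed ?E//; lra.
Qed.

Lemma same_curve_delayed2 beta t beta' t' : 0 <= t -> 0 <= t' ->
  same_curve (delayed beta) t (delayed beta') t' <->
  travelled t = travelled t' /\
  forall r, 0 <= r <= travelled t' -> line beta r = line beta' r.
Proof.
move=> t0 t0'; rewrite /same_curve (arclen_delayed _ t0) (arclen_delayed _ t0').
have /andP[_ tt] := travelled_bounds t.
split => -[ts E]; split; [exact: ts|move=> r rs|exact: ts|move=> r rs].
- have rl : 0 <= r <= total by rewrite (andP rs).1 (le_trans _ tt)// ts (andP rs).2.
  by rewrite -(arc_reparam_delayed beta rl) -(arc_reparam_delayed beta' rl) E// ts.
- have rl : 0 <= r <= total by rewrite (andP rs).1 (le_trans _ tt)// (andP rs).2.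
  by rewrite (arc_reparam_delayed beta rl) (arc_reparam_delayed beta' rl) E// -ts.
Qed.

Lemma line_not_constant beta r0 : 0 <= r0 < total ->
  exists r1 r2, [/\ r0 <= r1 , r0 <= r2 & line beta r1 <> line beta r2].
Proof.
move=> /andP[r00 r0t].
have [||n /andP[n1 n2]] := @node_exists _ _ _ H0 rho0 rho1 ((r0 + total) / 2); try lra.
exists (Num.max r0 (node n)), ((r0 + total) / 2); split; [by rewrite le_max lexx|lra|].
have m1 : Num.max r0 (node n) < (r0 + total) / 2 by rewrite gt_max n1 andbT; lra.
have m2 : node n <= Num.max r0 (node n) by rewrite le_max lexx orbT.
rewrite (line_edge d H0 rho0 rho1 beta (n := n)); last by rewrite m2 (le_trans (ltW m1)).
rewrite (line_edge d H0 rho0 rho1 beta (n := n) (s := (r0 + total) / 2)); last by rewrite n2 ltW.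
move/addrI/rowP/(_ (axis d n)); rewrite !mxE !eqxx !mulr1 /sgb; case: ifP => _; lra.
Qed.

Lemma stop_time_delayed (chi : R -> R -> 'rV[R]_d.+1) theta beta :
  chi theta = delayed beta -> stop_time chi theta = 1 + total.
Proof.
move=> chiE; have tot0 := total_gt0 H0 rho1; rewrite /stop_time chiE; apply: inf_minimum.
  split; first lra.
  move=> t tl; rewrite /delayed line_ge_total//; last lra.
  by rewrite [RHS]line_ge_total//; lra.
move=> T [T0 HT]; rewrite leNgt; apply/negP => TT.
have [|r1 [r2 [h1 h2]]] := @line_not_constant beta (Num.max 0 (T - 1)).
  by rewrite le_max lexx/= gt_max tot0/=; lra.
move: h1 h2; rewrite !ge_max => /andP[h1 h3] /andP[h2 h4]; apply.
have := HT (r1 + 1); have := HT (r2 + 1); rewrite /delayed !addrK.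
by move=> -> //; [move=> -> //; lra|lra].
Qed.

End curves_of_lines.

(** * The bisection words of the points of the space *)

Section bisection.
Context {R : realType}.
Variable d : nat.
Variables H rho : R.
Hypothesis H0 : 0 < H.
Hypothesis rho0 : 0 < rho.
Hypothesis rho1 : rho < 1.
Implicit Types (x : 'rV[R]_d.+1) (m n : nat) (w : seq bool).
Local Notation center := (center d H rho).
Local Notation axis := (axis d).
Local Notation step := (step H rho).

(** The n-th bit of a point says on which side it lies of the hyperplane
    orthogonal to the n-th axis through the center of the cell known so far. *)
Fixpoint point_word x n : seq bool :=
  if n is n'.+1 then
    let w := point_word x n' in
    rcons w (center w ord0 (axis n') <= x ord0 (axis n'))
  else [::].

Lemma size_point_word x n : size (point_word x n) = n.
Proof. by elim: n => //= n IH; rewrite size_rcons IH. Qed.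

Lemma center_rcons w b i : center (rcons w b) ord0 i =
  center w ord0 i + sgb b * step (size w) * (axis (size w) == i)%:R.
Proof.
rewrite !mxE size_rcons big_nat_recr//=; congr (_ + _).
  by apply: eq_big_nat => m /andP[_ mw]; rewrite nth_rcons mw.
by rewrite nth_rcons ltnn eqxx.
Qed.

Lemma center_rcons_dist w b : `|center (rcons w b) - center w| <= step (size w).
Proof.
have s0 := step_gt0 H0 rho0 (size w).
apply: norm_row_le => [|i]; first exact: ltW.
rewrite mxE center_rcons [X in _ + X]mxE addrAC subrr add0r.
rewrite normrM (normrM (sgb b)) (ger0_norm (ltW s0)).
have -> : `|sgb b| = 1 :> R by rewrite /sgb; case: (b); rewrite ?normrN normr1.
by rewrite mul1r; case: (_ == _); rewrite ?normr1 ?normr0 ?mulr1 ?mulr0// ltW.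
Qed.

Lemma axis_addd n : axis (n + d.+1) = axis n.
Proof. by rewrite /axis modnDr. Qed.

Lemma axis_neq n m : (n < m < n + d.+1)%N -> axis n != axis m.
Proof.
move=> /andP[nm mn]; apply/eqP => /(congr1 val); rewrite !val_insubd !ltn_pmod//.
move=> /eqP E; have : m == n %[mod d.+1] by rewrite eq_sym.
rewrite eqn_mod_dvd ?(ltnW nm)// => /dvdn_leq; rewrite subn_gt0 nm => /(_ isT).
by rewrite leqNgt ltn_subLR ?mn// ltnW.
Qed.

Lemma axis_onto n (i : 'I_d.+1) : exists m, (n <= m < n + d.+1)%N /\ axis m = i.
Proof.
have id := ltn_ord i; have nd := ltn_pmod n (isT : (0 < d.+1)%N).
exists (if (i < n %% d.+1)%N then n %/ d.+1 * d.+1 + d.+1 + i else n %/ d.+1 * d.+1 + i)%N.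
have nE := divn_eq n d.+1; split.
  by case: ltnP => h; lia.
apply/val_inj; rewrite /axis val_insubd ltn_pmod//.
by case: ltnP => h; rewrite -?addnA ?modnMDl ?modnDl modn_small.
Qed.

Variable L : R.
Hypothesis LH : L / 2 <= H.
Hypothesis rhod : rho ^+ d.+1 = 2^-1.

(** A coordinate is bisected once in every round of the axes, and a round halves
    the steps. Hence after each bisection the error is at most twice the step of
    the next bisection of this coordinate. *)
Lemma point_word_coord x : cube L x -> forall n m, (n <= m < n + d.+1)%N ->
  `|x ord0 (axis m) - center (point_word x n) ord0 (axis m)| <= 2 * step m.
Proof.
move=> cx; elim=> [|n IH] m /andP[nm mn].
  rewrite /= mxE big_nil subr0; apply: le_trans (cx _) _; apply: le_trans LH _.
  have : rho ^+ d.+1 <= rho ^+ m by rewrite ler_wiXn2l// ?ltW//; lia.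
  rewrite rhod stepE; have := H0; nra.
rewrite /= center_rcons size_point_word.
have [mnd|mnd] := ltnP m (n + d.+1).
  rewrite (negbTE (axis_neq _)) ?mulr0 ?addr0; last by rewrite mnd andbT.
  by apply: IH; rewrite mnd ltnW.
have {mn mnd nm} -> : m = (n + d.+1)%N by lia.
rewrite axis_addd eqxx mulr1.
have nn : (n <= n < n + d.+1)%N by lia.
have := IH n nn.
have -> : step (n + d.+1) = step n / 2 by rewrite !stepE exprD rhod mulrA.
rewrite /sgb; set a := x _ _; set c := center _ _ _; have := step_gt0 H0 rho0 n.
rewrite !ler_norml => s0 /andP[h1 h2]; case: (leP c a) => h; apply/andP; split; lra.
Qed.

Lemma point_word_dist x n : cube L x -> `|x - center (point_word x n)| <= 2 * step n.
Proof.
move=> cx; have s0 := step_gt0 H0 rho0 n.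
apply: norm_row_le => [|j]; first lra.
rewrite mxE [X in _ + X]mxE; have [m [nm <-]] := axis_onto n j.
apply: le_trans (point_word_coord cx nm) _.
rewrite ler_pM2l// !stepE ler_pM2l// ler_wiXn2l// ?ltW//; lia.
Qed.

Lemma point_word_measurable n w :
  @measurable _ (borel_rV R d.+1) [set x : 'rV[R]_d.+1 | point_word x n = w].
Proof.
elim: n w => [|n IH] w /=.
  have [->|w0] := eqVneq w [::].
    by rewrite (_ : mkset _ = setT)//; apply/seteqP; split.
  rewrite (_ : mkset _ = set0); first exact: measurable0.
  by apply/seteqP; split => // x /= w0'; rewrite -w0' in w0.
case: (lastP w) => [|v b].
  rewrite (_ : mkset _ = set0); first exact: measurable0.
  by apply/seteqP; split => // x /= /(congr1 size); rewrite size_rcons.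
pose C : set 'rV[R]_d.+1 := [set x | center v ord0 (axis n) <= x ord0 (axis n)].
have mC : @measurable _ (borel_rV R d.+1) C.
  rewrite -[C]setCK; apply: measurableC; apply: sub_sigma_algebra.
  rewrite openC; apply: (@preimage_closed _ _ (fun x : 'rV[R]_d.+1 => x ord0 (axis n))
    [set y | center v ord0 (axis n) <= y]) => [x _|]; last exact: closed_ge.
  exact: coord_continuous.
rewrite (_ : mkset _ = [set x | point_word x n = v] `&` (if b then C else ~` C)).
  by apply: measurableI => //; case: b => //; exact: measurableC.
apply/seteqP; split => x /=.
  move=> /rcons_inj[-> Cb]; split => //; case: b Cb => //.
  by rewrite /C /= => ->.
move=> [-> Cb]; congr rcons; case: b Cb => //.
by move=> /negP/negbTE.
Qed.

Lemma cube_measurable (L' : R) : @measurable _ (borel_rV R d.+1) (cube L' : set 'rV[R]_d.+1).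
Proof.
rewrite (_ : cube L' = \bigcap_(i in [set: 'I_d.+1]) [set x : 'rV[R]_d.+1 | `|x ord0 i| <= L' / 2]); last first.
  by apply/seteqP; split => [x cx i _|x cx i]; [exact: cx|exact: (cx i Logic.I)].
apply: fin_bigcap_measurable => // i _.
rewrite -[X in measurable X]setCK; apply: measurableC; apply: sub_sigma_algebra.
rewrite openC; apply: (@preimage_closed _ _ (fun x : 'rV[R]_d.+1 => `|x ord0 i|)
    [set y | y <= L' / 2]) => [x _|]; last exact: closed_le.
apply: (@continuous_comp _ _ _ (fun x : 'rV[R]_d.+1 => x ord0 i) (fun y : R => `|y|)).
  exact: coord_continuous.
exact: norm_continuous.
Qed.

End bisection.

(** * The distribution of the end points of the lines *)

Section end_points.
Context {R : realType}.
Variable d : nat.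
Variables H rho : R.
Hypothesis H0 : 0 < H.
Hypothesis rho0 : 0 < rho.
Hypothesis rho1 : rho < 1.
Local Notation center := (center d H rho).
Local Notation total := (total H rho).

Context dT (T : measurableType dT).
Variable m : {measure set T -> \bar R}.
Variables (D : set T) (W : nat -> T -> seq bool) (X : T -> 'rV[R]_d.+1).
Hypothesis mD : measurable D.
Hypothesis sizeW : forall n x, D x -> size (W n x) = n.
Hypothesis WS : forall n x, D x -> exists b, W n.+1 x = rcons (W n x) b.
Hypothesis mW : forall n w, measurable (D `&` [set x | W n x = w]).
Hypothesis XW : forall n x, D x -> `|X x - center (W n x)| <= 2 * total * rho ^+ n.

(** The cells of level n whose neighbourhood of size twice the error bound lies
    in U. The doubled radius makes these cells increase to U with n. *)
Definition deep_cell (U : set 'rV[R]_d.+1) n w : Prop :=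
  forall y, `|y - center w| < 4 * total * rho ^+ n -> U y.

Let rn0 n : 0 < rho ^+ n. Proof. exact: exprn_gt0. Qed.

Lemma preimage_deep_cells U : open U ->
  D `&` X @^-1` U = \bigcup_n (D `&` [set x | deep_cell U n (W n x)]).
Proof.
move=> oU; have t0 := total_gt0 H0 rho1; apply/seteqP; split => [x [Dx UX]|x [n _ [Dx UX]]]; last first.
  split => //; apply: UX; apply: le_lt_trans (XW n Dx) _.
  have := rn0 n; nra.
have /nbhs_ballP[e /= e0 eU] : nbhs (X x) U by apply: open_nbhs_nbhs.
have /cvgr0Pnorm_lt/(_ (e / (6 * total))) : rho ^+ n @[n --> \oo] --> 0.
  by apply: cvg_expr; rewrite ger0_norm// ltW.
case; first by rewrite divr_gt0// mulr_gt0.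
move=> N _ /(_ N (leqnn N)); rewrite ger0_norm ?(ltW (rn0 N))//.
rewrite ltr_pdivlMr => [hN|]; last by apply: mulr_gt0.
exists N => //; split => // y hy; apply: eU; rewrite -ball_normE /ball_/=.
rewrite -(subrK (center (W N x)) (X x)) -addrA; apply: le_lt_trans (ler_normD _ _) _.
have := XW N Dx; rewrite [`|center _ - y|]distrC; lra.
Qed.

Lemma deep_cells_nondecreasing U :
  {homo (fun n => D `&` [set x | deep_cell U n (W n x)]) : n p / (n <= p)%N >-> (n <= p)%O}.
Proof.
apply: homo_leq => [A //|A B C /= AB BC|n]; first exact: le_trans AB BC.
apply/subsetPset => x [Dx UX]; split => // y /=; have [b ->] := WS n Dx => hy.
apply: UX; have t0 := total_gt0 H0 rho1.
rewrite -(subrK (center (rcons (W n x) b)) y) -addrA.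
apply: le_lt_trans (ler_normD _ _) _.
have := center_rcons_dist d H0 rho0 (W n x) b; rewrite sizeW//.
have -> : step H rho n = total * (1 - rho) * rho ^+ n.
  by rewrite stepE totalE; field; rewrite subr_eq0 gt_eqF.
move: hy; rewrite exprS; have := rn0 n.
set a := `|_|; set b' := `|_|; set r := rho ^+ n => r0 ha hb.
have h1 : 0 < 1 - rho by rewrite subr_gt0.
have : 0 < total * (1 - rho) * r by apply: mulr_gt0 => //; exact: mulr_gt0.
lra.
Qed.

Lemma end_point_measurable U : open U -> measurable (D `&` X @^-1` U).
Proof.
move=> oU; rewrite preimage_deep_cells//; apply: bigcupT_measurable => n.
exact: (measurable_words (@sizeW n) (mW n) (deep_cell U n)).
Qed.

(** The measure of an open set is read off the masses of the words. This is used
    both for the end points of the lines, under the Lebesgue measure, and for the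
    points of the cube themselves, under mu: the words have the same masses in
    the two cases. *)
Lemma end_point_measure U : open U ->
  (\sum_(t : n.-tuple bool) (`[< deep_cell U n t >]%:R : R)%:E *
    m (D `&` [set x | W n x = t]))%E @[n --> \oo] --> m (D `&` X @^-1` U).
Proof.
move=> oU; rewrite (preimage_deep_cells oU).
under eq_cvg => n do
  rewrite -(measure_words m mD (@sizeW n) (mW n) (deep_cell U n)).
apply: nondecreasing_cvg_mu.
- by move=> n; exact: (measurable_words (@sizeW n) (mW n) (deep_cell U n)).
- by rewrite -preimage_deep_cells//; exact: end_point_measurable.
- exact: deep_cells_nondecreasing.
Qed.

End end_points.

Section end_point_law.
Context {R : realType}.
Variable d : nat.
Variables (H rho L M : R) (mu : {measure set (borel_rV R d.+1) -> \bar R}).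
Hypothesis H0 : 0 < H.
Hypothesis rho0 : 0 < rho.
Hypothesis rho1 : rho < 1.
Hypothesis LH : L / 2 <= H.
Hypothesis rhod : rho ^+ d.+1 = 2^-1.
Hypothesis muT : mu setT = M%:E.
Hypothesis mucube : mu (~` cube L) = 0%E.

Definition cell_mass (w : seq bool) : R :=
  fine (mu [set x : 'rV[R]_d.+1 | point_word H rho x (size w) = w]).

Let mcell n w : @measurable _ (borel_rV R d.+1) [set x : 'rV[R]_d.+1 | point_word H rho x n = w].
Proof. exact: point_word_measurable. Qed.

Lemma mu_fin (A : set (borel_rV R d.+1)) : measurable A -> mu A \is a fin_num.
Proof.
move=> mA; rewrite ge0_fin_numE//; apply: le_lt_trans (_ : mu setT < +oo)%E.
  by apply: le_measure; rewrite ?inE.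
by rewrite muT ltry.
Qed.

Lemma mu_cube (A : set (borel_rV R d.+1)) : measurable A -> mu (cube L `&` A) = mu A.
Proof.
move=> mA; have mC := @cube_measurable _ d L; rewrite setIC.
rewrite -[in RHS](setIT A) -(setUCr (cube L)) setIUr measureU.
- rewrite [X in (_ + X)%E](_ : _ = 0%E) ?adde0//.
  apply/eqP; rewrite eq_le measure_ge0 andbT -mucube; apply: le_measure; rewrite ?inE.
  + by apply: measurableI => //; exact: measurableC.
  + exact: measurableC.
  + by move=> x [].
- exact: measurableI.
- by apply: measurableI => //; exact: measurableC.
- by apply/seteqP; split => // x [[_ ?] []].
Qed.

Lemma cell_massE w :
  mu [set x : 'rV[R]_d.+1 | point_word H rho x (size w) = w] = (cell_mass w)%:E.
Proof. by rewrite /cell_mass fineK//; apply: mu_fin; exact: mcell. Qed.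

Lemma cell_mass_ge0 w : 0 <= cell_mass w.
Proof. exact: fine_ge0. Qed.

Lemma cell_mass_nil : cell_mass [::] = M.
Proof.
rewrite /cell_mass (_ : mkset _ = setT) ?muT//.
by apply/seteqP; split.
Qed.

Lemma cell_massD w : cell_mass (rcons w false) + cell_mass (rcons w true) = cell_mass w.
Proof.
apply: EFin_inj; rewrite EFinD -!cell_massE !size_rcons -measureU.
- congr (mu _); apply/seteqP; split => x /=; first by case=> /rcons_inj[->].
  move=> ->; case: (_ <= _); [by right|by left].
- exact: mcell.
- exact: mcell.
- by apply/seteqP; split => // x [/= -> /rcons_inj[]].
Qed.

Let dom : set R := [set theta | 0 <= theta <= M].
Let arrival theta : 'rV[R]_d.+1 := line d H rho (code cell_mass theta) (total H rho).

Let arrival_dist n theta : dom theta ->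
  `|arrival theta - center d H rho (word cell_mass theta n)| <= 2 * total H rho * rho ^+ n.
Proof.
move=> _; rewrite /word -(line_node d H0 rho0 rho1).
apply: le_trans (line_norm _ H0 rho0 rho1 _ _ _) _.
rewrite ger0_norm ?total_sub_node; last by rewrite mulr_ge0 ?exprn_ge0 ?ltW ?total_gt0.
have := total_gt0 H0 rho1; have : 0 < rho ^+ n by exact: exprn_gt0.
nra.
Qed.

Let mdom : @measurable _ (lebesgueTypeR R) dom := dom_measurable M.
Let cyl n w := cylinder_measurable cell_mass_ge0 cell_mass_nil cell_massD n w.
Let wordS_ex n theta : dom theta ->
  exists b, word cell_mass theta n.+1 = rcons (word cell_mass theta n) b.
Proof. by move=> _; exists (code cell_mass theta n); rewrite wordS. Qed.

Lemma arrival_measurable U : open U -> @measurable _ (lebesgueTypeR R) (dom `&` arrival @^-1` U).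
Proof.
exact: (@end_point_measurable R d H rho H0 rho0 rho1 _ (lebesgueTypeR R) dom
  (fun n theta => word cell_mass theta n) arrival
  (fun n theta _ => size_word cell_mass theta n) cyl arrival_dist).
Qed.

Lemma arrival_law_open U : open U ->
  completed_lebesgue_measure (dom `&` arrival @^-1` U) = mu U.
Proof.
move=> oU.
have mU : @measurable _ (borel_rV R d.+1) U by exact: sub_sigma_algebra.
have mC := @cube_measurable _ d L.
rewrite -(mu_cube mU).
have c1 := @end_point_measure R d H rho H0 rho0 rho1 _ (lebesgueTypeR R) completed_lebesgue_measure
  dom (fun n theta => word cell_mass theta n) arrival mdom
  (fun n theta _ => size_word cell_mass theta n) wordS_ex cyl arrival_dist U oU.
have mC' n w : @measurable _ (borel_rV R d.+1) (cube L `&` [set x : 'rV[R]_d.+1 | point_word H rho x n = w]).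
  by apply: measurableI => //; exact: mcell.
have XW n (x : 'rV[R]_d.+1) : cube L x -> `|id x - center d H rho (point_word H rho x n)| <= 2 * total H rho * rho ^+ n.
  move=> cx; apply: le_trans (point_word_dist H0 rho0 rho1 LH rhod n cx) _.
  have HT : H <= total H rho by rewrite /total ler_pdivlMr ?subr_gt0//; have := mulr_gt0 H0 rho0; lra.
  by rewrite /step mulrA ler_pM2r ?exprn_gt0// ler_pM2l.
have WS n (x : 'rV[R]_d.+1) : cube L x -> exists b, point_word H rho x n.+1 = rcons (point_word H rho x n) b.
  by move=> _; eexists.
have c2 := @end_point_measure R d H rho H0 rho0 rho1 _ (borel_rV R d.+1) mu
  (cube L) (fun n x => point_word H rho x n) id mC
  (fun n x _ => size_point_word H rho x n) WS mC' XW U oU.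
rewrite -(cvg_lim _ c1)// -(cvg_lim _ c2)//; congr (limn _); apply/funext => n.
apply: eq_bigr => t _; congr (_ * _)%E.
transitivity (cell_mass t)%:E.
  exact: (cylinder_measure cell_mass_ge0 cell_mass_nil cell_massD (size_tuple t)).
have := cell_massE t; rewrite size_tuple => <-.
set A := mkset _; have mA : @measurable _ (borel_rV R d.+1) A by exact: mcell.
by rewrite mu_cube.
Qed.

(* The extension by 0 is measurable on the whole line, as a pushforward
   requires. *)
Let stop theta : 'rV[R]_d.+1 := if theta \in dom then arrival theta else 0.

Let measurable_stop : @measurable_fun _ _ (lebesgueTypeR R) (borel_rV R d.+1) setT stop.
Proof.
apply: (@measurability _ _ (lebesgueTypeR R) (borel_rV R d.+1) setT stop (@open 'rV[R]_d.+1)) => // _ [U oU <-]; rewrite setTI.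
rewrite (_ : stop @^-1` U = (dom `&` arrival @^-1` U) `|` (~` dom `&` [set _ | U 0])).
  apply: measurableU; first exact: arrival_measurable.
  apply: measurableI; first exact: measurableC.
  have [U0|U0] := pselect (U 0).
    by rewrite (_ : mkset _ = setT)//; apply/seteqP; split.
  by rewrite (_ : mkset _ = set0)//; apply/seteqP; split.
apply/seteqP; split => theta; rewrite /stop /=.
  by case: ifPn => [/set_mem dt Ut|/negP dt Ut]; [left|right; split => // /mem_set].
by move=> [[/mem_set -> //]|[dt U0]]; rewrite ifF//; apply/negP => /set_mem.
Qed.

(** Two finite measures that agree on the open sets agree on the Borel sets. *)
Lemma arrival_law (V : set (borel_rV R d.+1)) : measurable V ->
  completed_lebesgue_measure (dom `&` arrival @^-1` V) = mu V.
Proof.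
move=> mV.
pose restricted := mrestr completed_lebesgue_measure mdom.
have [nu nuE] : exists nu : {measure set (borel_rV R d.+1) -> \bar R}, forall A,
    nu A = completed_lebesgue_measure (dom `&` arrival @^-1` A).
  unshelve refine (ex_intro _ (pushforward restricted
    (stop : lebesgueTypeR R -> borel_rV R d.+1) : {measure set _ -> \bar R}) _).
    exact: measurable_stop.
  move=> A; rewrite /= /pushforward /restricted /mrestr; congr completed_lebesgue_measure.
  apply/seteqP; split => theta [] /=; rewrite /stop.
    by move=> + dt; rewrite mem_set.
  by move=> dt; rewrite mem_set.
rewrite -nuE; apply: (@measure_unique _ _ (borel_rV R d.+1) (@open 'rV[R]_d.+1) (fun=> setT)) => //.
- by move=> A B; exact: openI.
- by move=> _; exact: openT.
- by rewrite bigcup_const//; exists 0%N.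
- by move=> A oA; rewrite nuE arrival_law_open.
- by move=> _; rewrite nuE arrival_law_open ?muT ?ltry//; exact: openT.
Qed.

End end_point_law.

(** * The dyadic irrigation plan *)

Section plan.
Context {R : realType}.
Variable d : nat.
Variables (H rho M : R) (mass : seq bool -> R).
Hypothesis H0 : 0 < H.
Hypothesis rho0 : 0 < rho.
Hypothesis rho1 : rho < 1.
Hypothesis M0 : 0 < M.
Hypothesis mass_ge0 : forall w, 0 <= mass w.
Hypothesis mass_nil : mass [::] = M.
Hypothesis massD : forall w, mass (rcons w false) + mass (rcons w true) = mass w.
Implicit Types (theta s t r l : R) (m n : nat).
Local Notation line := (line d H rho).
Local Notation node := (node H rho).
Local Notation total := (total H rho).
Local Notation travelled := (travelled H rho).
Local Notation word := (word mass).

Definition plan theta t : 'rV[R]_d.+1 := delayed d H rho (code mass theta) t.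

Let dom : set R := [set theta | 0 <= theta <= M].
Let mdom : @measurable _ (lebesgueTypeR R) dom := dom_measurable M.
Let cyl n w := cylinder_measurable mass_ge0 mass_nil massD n w.
Let cylE n w := cylinder_measure mass_ge0 mass_nil massD (n := n) (w := w).

Lemma word_set_measurable n (P : set (seq bool)) :
  @measurable _ (lebesgueTypeR R) (dom `&` [set theta | P (word theta n)]).
Proof.
exact: (@measurable_words _ (lebesgueTypeR R) dom (fun theta => word theta n) n
  (fun theta _ => size_word mass theta n) (cyl n) P).
Qed.

Lemma word_set_measure n (P : set (seq bool)) :
  completed_lebesgue_measure (dom `&` [set theta | P (word theta n)]) =
  (\sum_(t : n.-tuple bool) (`[< P t >]%:R : R)%:E * (mass t)%:E)%E.
Proof.
rewrite (@measure_words _ (lebesgueTypeR R) _ completed_lebesgue_measure dom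
  (fun theta => word theta n) n mdom (fun theta _ => size_word mass theta n) (cyl n) P).
apply: eq_bigr => t _; congr (_ * _)%E; exact: (cylE (size_tuple t)).
Qed.

Lemma lines_agreeP beta beta' n s : node n < s <= node n.+1 ->
  (forall r, 0 <= r <= s -> line beta r = line beta' r) <->
  mkseq beta n.+1 = mkseq beta' n.+1.
Proof.
move=> /andP[ns sn]; split => [E|E r /andP[_ rs]].
  apply/eq_in_map => m; rewrite mem_iota add0n => /andP[_ mn].
  exact: (line_inj H0 rho0 rho1 ns E).
apply: (eq_line _ H0 rho0 rho1 (le_trans rs sn)) => m mn.
by rewrite -(nth_mkseq false beta mn) E nth_mkseq.
Qed.

Lemma word_measure n w : size w = n ->
  completed_lebesgue_measure [set theta | 0 <= theta <= M /\ word theta n = w] = (mass w)%:E.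
Proof. exact: cylE. Qed.

(** A line that follows another one into its n-th edge shares its bits up to the
    n-th one, and only these. *)
Lemma followers_measure theta n s : node n < s <= node n.+1 ->
  completed_lebesgue_measure [set theta' | 0 <= theta' <= M /\
    forall r, 0 <= r <= s -> line (code mass theta') r = line (code mass theta) r] =
  (mass (word theta n.+1))%:E.
Proof.
move=> ns; rewrite -(word_measure (size_word mass theta n.+1)); congr completed_lebesgue_measure.
by apply/seteqP; split => theta' [h E]; split => //; apply/(lines_agreeP _ _ ns).
Qed.

Lemma multiplicity_plan theta t n : 0 <= t -> node n < travelled t <= node n.+1 ->
  multiplicity M plan theta t = mass (word theta n.+1).
Proof.
move=> t0 tn; rewrite /multiplicity -[RHS]/(fine (mass (word theta n.+1))%:E).
rewrite -(followers_measure theta tn); congr (fine (completed_lebesgue_measure _)).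
apply/seteqP; split => theta' [h] => [[t' [t'0 /same_curve_delayed2]]|E].
  by move=> /(_ H0 rho0 rho1 (ltW t'0) t0) [_ E]; split.
have t1 : 0 < t.
  rewrite lt_neqAle t0 andbT; apply/eqP => tE; move: tn; rewrite -tE.
  by rewrite travelled_wait// => /andP[+ _]; rewrite ltNge (node_ge0 H0 rho0 rho1).
split; first exact: h.
exists t; split; first exact: t1.
exact: ((same_curve_delayed2 d H0 rho0 rho1 (code mass theta') (code mass theta) t0 t0).2 (conj (erefl _) E)).
Qed.

Lemma multiplicity_wait theta t : 0 <= t <= 1 -> multiplicity M plan theta t = M.
Proof.
move=> /andP[t0 t1]; have M_E := @word_measure 0 [::] erefl; rewrite mass_nil in M_E.
rewrite /multiplicity -[RHS]/(fine M%:E) -M_E; congr (fine (completed_lebesgue_measure _)).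
have tot0 := total_gt0 H0 rho1.
apply/seteqP; split => theta' [h _] //; split => //.
exists 1; split; first exact: ltr01.
apply: (same_curve_delayed2 d H0 rho0 rho1 (code mass theta') (code mass theta) ler01 t0).2.
rewrite !travelled_wait//; split; first by [].
move=> r /andP[_ r1]; rewrite (line_le0 _ H0 rho0 rho1 _ r1).
by rewrite (line_le0 _ H0 rho0 rho1 _ r1).
Qed.

Lemma travelled_level t : 1 < t < 1 + total -> exists n, node n < travelled t <= node n.+1.
Proof.
move=> t1; have -> : travelled t = t - 1.
  by apply: travelled_move; lra.
by apply: node_exists => //; lra.
Qed.

(** A particle whose multiplicity vanishes at some time has a word of mass zero,
    and there are countably many words. *)
Lemma plan_A2 : A2 M plan.
Proof.
have N0 : completed_lebesgue_measure.-negligible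
    (\bigcup_n (dom `&` [set theta | (fun w => mass w = 0) (word theta n)])).
  apply: negligible_bigcup => n.
  apply/negligibleP; first exact: (word_set_measurable n (fun w => mass w = 0)).
  apply: (eq_trans (word_set_measure n (fun w => mass w = 0))).
  apply: big1 => t _; rewrite -EFinM.
  by case: asboolP => [->|_]; rewrite ?mulr0 ?mul0r.
apply: negligibleS N0 => theta /not_implyP[h /existsNP[t /not_implyP[/andP[t0 ts] /negP]]].
have tot0 := total_gt0 H0 rho1.
rewrite -leNgt; have [t1|t1] := leP t 1.
  by rewrite multiplicity_wait ?t0// leNgt M0.
have [|n tn] := @travelled_level t.
  by rewrite t1; rewrite (@stop_time_delayed _ _ _ _ H0 rho0 rho1 _ _ (code mass theta)) in ts.
rewrite (multiplicity_plan _ t0 tn) => m0; exists n.+1 => //; split => //=.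
by apply/eqP; rewrite eq_le m0 mass_ge0.
Qed.

(** A set of positive measure is not empty: some particle runs through the whole
    path, which is thus a part of its line. *)
Lemma good_path_line eps p : 0 < eps -> good M plan eps p ->
  exists theta, [/\ 0 <= theta <= M, 0 <= len p <= total &
    forall r, 0 <= r <= len p -> crv p r = line (code mass theta) r].
Proof.
move=> e0 [l0 _ [_ pl] h].
have [theta [th [t [t0 E]]]] : [set theta | 0 <= theta <= M /\
    exists t, 0 < t /\ same_curve (plan theta) t (crv p) (len p)] !=set0.
  apply/set0P/negP => /eqP E0; move: h; rewrite E0 measure0.
  by rewrite lee_fin leNgt e0.
have ll : 0 <= len p <= len p by rewrite l0 lexx.
have [tE E'] := (same_curve_delayed H0 rho0 rho1 (code mass theta) (ltW t0) pl ll).1 E.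
exists theta; split => //; last by move=> r rl; rewrite E'.
by rewrite -tE; exact: travelled_bounds.
Qed.

Lemma flux_followers theta p l s : l <= total ->
  (forall r, 0 <= r <= l -> crv p r = line (code mass theta) r) -> 0 < s <= l ->
  flux M plan p s = fine (completed_lebesgue_measure [set theta' | 0 <= theta' <= M /\
    forall r, 0 <= r <= s -> line (code mass theta') r = line (code mass theta) r]).
Proof.
move=> ll pE /andP[s0 sl]; rewrite /flux; congr (fine (completed_lebesgue_measure _)).
have pl r : 0 <= r <= l -> arclen (crv p) r = r.
  move=> rl; apply: (arclen_line H0 rho0 rho1 (beta := code mass theta) _ ll rl).
  by move=> r' /andP[r'0 r'l]; apply: pE; rewrite !ltW.
have sl' : 0 <= s <= l by rewrite (ltW s0) sl.
apply/seteqP; split => theta' [h] => [[t [t0 E]]|E]; split => //.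
  have [_ E'] := (same_curve_delayed H0 rho0 rho1 (code mass theta') t0 pl sl').1 E.
  by move=> r rs; rewrite E' ?pE//; move: rs; lra.
exists (s + 1); split; first lra.
apply/(same_curve_delayed H0 rho0 rho1 (code mass theta') (l := l)) => //; first lra.
rewrite travelledD1; last by rewrite (ltW s0) (le_trans sl).
by split => // r rs; rewrite E ?pE//; move: rs; lra.
Qed.

Lemma flux_line theta p l n s : l <= total ->
  (forall r, 0 <= r <= l -> crv p r = line (code mass theta) r) ->
  node n < s <= node n.+1 -> s <= l ->
  flux M plan p s = mass (word theta n.+1).
Proof.
move=> ll pE ns sl.
have s0 : 0 < s by apply: le_lt_trans (andP ns).1; exact: node_ge0.
by rewrite (flux_followers ll pE) ?s0 ?sl// (followers_measure theta ns).
Qed.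

Lemma flux_noninc theta p l s t : l <= total ->
  (forall r, 0 <= r <= l -> crv p r = line (code mass theta) r) ->
  0 < s -> s <= t -> t <= l -> flux M plan p t <= flux M plan p s.
Proof.
move=> ll pE s0 st tl.
rewrite !(flux_followers ll pE) ?s0 ?(lt_le_trans s0) ?(le_trans st)//.
have monotone (A B : set R) : A `<=` B ->
    (completed_lebesgue_measure A <= completed_lebesgue_measure B)%E.
  by move=> AB; exact: (le_outer_measure (wlength idfun)^*%mu).
have fin (P : set R) : completed_lebesgue_measure
    [set theta' | 0 <= theta' <= M /\ P theta'] \is a fin_num.
  rewrite ge0_fin_numE; last exact: outer_measure_ge0.
  apply: (@le_lt_trans _ _ (mass [::])%:E); last exact: ltry.
  by rewrite -(@word_measure 0 [::])//; apply: monotone => theta' [].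
apply: fine_le; [exact: fin|exact: fin|apply: monotone].
by move=> theta' [h E]; split => // r /andP[r0 rs]; apply: E; rewrite r0 (le_trans rs).
Qed.

End plan.

Section plan_irrigates.
Context {R : realType}.
Variable d : nat.
Variables (H rho L M : R) (mu : {measure set (borel_rV R d.+1) -> \bar R}).
Hypothesis H0 : 0 < H.
Hypothesis rho0 : 0 < rho.
Hypothesis rho1 : rho < 1.
Hypothesis LH : L / 2 <= H.
Hypothesis rhod : rho ^+ d.+1 = 2^-1.
Hypothesis muT : mu setT = M%:E.
Hypothesis mucube : mu (~` cube L) = 0%E.
Local Notation mass := (cell_mass H rho mu).
Local Notation chi := (plan d H rho mass).

Let mass_ge0 : forall w, 0 <= mass w. Proof. exact: cell_mass_ge0. Qed.
Let mass_nil : mass [::] = M. Proof. exact: cell_mass_nil. Qed.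
Let massD w : mass (rcons w false) + mass (rcons w true) = mass w.
Proof. exact: (cell_massD _ _ muT). Qed.

Lemma plan_measurable_at t : @measurable_fun _ _ (lebesgueTypeR R) (borel_rV R d.+1)
  `[0, M] (fun theta => chi theta t).
Proof.
have dE : `[0, M]%classic = [set theta | 0 <= theta <= M].
  by apply/seteqP; split => x; rewrite /= in_itv.
apply: (@measurability _ _ (lebesgueTypeR R) (borel_rV R d.+1) _ _ (@open 'rV[R]_d.+1)) => //.
move=> _ [U oU <-]; rewrite dE /plan /delayed.
have [tt|tt] := leP (total H rho) (t - 1).
  rewrite [X in measurable X](_ : _ = [set theta | 0 <= theta <= M] `&`
     (fun theta => line d H rho (code mass theta) (total H rho)) @^-1` U).
    exact: arrival_measurable.
  by congr (_ `&` _); apply/seteqP; split => theta /=; rewrite [line _ _ _ _ (t - 1)]line_ge_total.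
have [n tn] : exists n, t - 1 <= node H rho n.
  have [t0|t0] := leP (t - 1) 0; first by exists 0%N; rewrite node0.
  by have [n /andP[_ ?]] := node_exists H0 rho0 rho1 t0 tt; exists n.+1.
rewrite [X in measurable X](_ : _ = [set theta | 0 <= theta <= M] `&`
   [set theta | (fun w => U (line d H rho (nth false w) (t - 1))) (word mass theta n)]).
  exact: (word_set_measurable mass_ge0 mass_nil massD n
    (fun w => U (line d H rho (nth false w) (t - 1)))).
have E theta : line d H rho (code mass theta) (t - 1) =
    line d H rho (nth false (word mass theta n)) (t - 1).
  by apply: (eq_line _ H0 rho0 rho1 tn) => m mn; rewrite nth_mkseq.
by congr (_ `&` _); apply/seteqP; split => theta /=; rewrite E.
Qed.

Lemma plan_irrigation : irrigation_plan mu M chi.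
Proof.
have tot0 := total_gt0 H0 rho1.
split.
- by move=> t _; exact: plan_measurable_at.
- by move=> theta _; apply: continuous_subspaceT; exact: delayed_continuous.
- by move=> theta _; rewrite /plan delayed0.
- apply: aeW => theta _; split.
    by move=> s t _ _; exact: delayed_lipschitz.
  exists (1 + total H rho); split; first lra.
  move=> t tl; rewrite /plan /delayed line_ge_total//; last lra.
  by rewrite [RHS]line_ge_total//; lra.
- move=> V mV; rewrite -(arrival_law H0 rho0 rho1 LH rhod muT mucube mV).
  congr completed_lebesgue_measure; apply/seteqP; split => theta [h] /=.
    move=> Vt; split => //; rewrite (stop_time_delayed H0 rho0 rho1 (beta := code mass theta))//.
    by rewrite /plan /delayed addrAC subrr add0r.
  rewrite (stop_time_delayed H0 rho0 rho1 (beta := code mass theta))//.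
  by rewrite /plan /delayed addrAC subrr add0r.
Qed.

End plan_irrigates.

(** * Growth of the function f *)

Section growth.
Context {R : realType}.
Variables (f : R -> R) (beta : R).
Hypothesis f_ge0 : forall z, 0 <= z -> 0 <= f z.
Hypothesis f_smooth : forall z, 0 < z ->
  derivable f z 1 /\ derivable (derive1 f) z 1.
Hypothesis f_0 : f 0 = 0.
Hypothesis f_incr : forall z, 0 < z -> 0 < derive1 f z.
Hypothesis f_concave : forall z, 0 < z -> derive1n 2 f z <= 0.
Hypothesis beta0 : 0 <= beta.
Hypothesis beta1 : beta < 1.
Hypothesis f_beta : (limf_esup (fun z : R => (z `^ (- beta) * f z)%:E) (0^'+) < +oo)%E.

Lemma f_near0 : exists C delta, [/\ 0 <= C, 0 < delta &
  forall z, 0 < z < delta -> f z <= C * z `^ beta].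
Proof.
move: f_beta => /ereal_inf_lt[_ [V V0 <-]] supV.
have [C C0 CV] : exists2 C : R, 0 <= C &
    (ereal_sup [set (z `^ (- beta) * f z)%:E | z in V] <= C%:E)%E.
  case: (ereal_sup _) supV => [r _| //|_]; last by exists 0 => //; rewrite leNye.
  by exists (Num.max 0 r); rewrite ?le_max ?lexx// lee_fin le_max lexx orbT.
move: V0 => /nbhs_ballP[e /= e0 eV].
exists C, e; split => // z /andP[z0 ze].
have Vz : V z by apply: eV => //; rewrite -ball_normE /ball_/= sub0r normrN gtr0_norm.
have zb : 0 < z `^ beta by rewrite powR_gt0.
have : (((z `^ (- beta) * f z)%:E) <= C%:E)%E.
  by apply: le_trans CV; apply: ereal_sup_ubound; exists z.
by rewrite lee_fin powRN mulrC ler_pdivrMr.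
Qed.

Lemma f_le1 z : 0 < z <= 1 -> f z <= f 1.
Proof.
move=> /andP[z0 z1].
apply: (@ger0_derive1_ndecr _ f z 1) => //.
- by move=> x; rewrite in_itv/= => /andP[zx _]; exact: (f_smooth (lt_trans z0 zx)).1.
- move=> x; rewrite in_itv/= => /andP[zx _]; exact: ltW (f_incr (lt_trans z0 zx)).
- apply: derivable_within_continuous => x; rewrite in_itv/= => /andP[zx _].
  exact: (f_smooth (lt_le_trans z0 zx)).1.
Qed.

Lemma f_tangent z : 1 < z -> f z <= f 1 + derive1 f 1 * (z - 1).
Proof.
move=> z1.
have pos (x : R) : 1 <= x -> 0 < x by apply: lt_le_trans.
have [c c1z E] : exists2 c, c \in `]1, z[ & f z - f 1 = derive1 f c * (z - 1).
  apply: (MVT z1) => [x|].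
    rewrite in_itv/= derive1E => /andP[/ltW/pos/f_smooth[fx _] _].
    exact: derivableP.
  apply: derivable_within_continuous => x; rewrite in_itv/= => /andP[zx _].
  exact: (f_smooth (pos _ zx)).1.
rewrite -lerBlDl E ler_pM2r ?subr_gt0//.
move: c1z; rewrite in_itv/= => /andP[c1 cz].
apply: (@ler0_derive1_le_cc _ (derive1 f) 1 z);
  rewrite ?in_itv/= ?lexx ?(ltW c1) ?(ltW cz) ?(ltW z1)//.
- by move=> x; rewrite in_itv/= => /andP[/ltW/pos/f_smooth[_ ? _]].
- by move=> x; rewrite in_itv/= => /andP[/ltW/pos/f_concave].
- apply: derivable_within_continuous => x; rewrite in_itv/= => /andP[zx _].
  exact: (f_smooth (pos _ zx)).2.
Qed.

Lemma powR_affine (lam z : R) : 0 < lam -> 0 < z ->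
  z `^ beta <= lam `^ (beta - 1) * (z + lam).
Proof.
move=> l0 z0.
have split (x : R) : 0 < x -> x `^ beta = x `^ (beta - 1) * x.
  move=> x0; rewrite -[X in _ * X](powRr1 (ltW x0)) -powRD ?subrK//.
  by apply/implyP => _; rewrite gt_eqF.
have lb : 0 < lam `^ (beta - 1) by rewrite powR_gt0.
have [zl|lz] := leP z lam.
  rewrite (@le_trans _ _ (lam `^ beta))//; last first.
    by rewrite split// ler_pM2l// lerDr ltW.
  by rewrite ge0_ler_powR// nnegrE ltW.
rewrite split// (@le_trans _ _ (lam `^ (beta - 1) * z))//; last first.
  by rewrite ler_pM2l// lerDl ltW.
rewrite ler_pM2r// -opprB !powRN lef_pV2 ?posrE ?powR_gt0//.
by rewrite ge0_ler_powR ?nnegrE ?subr_ge0 ?ltW.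
Qed.

(** Near 0 the function f is at most a power, and farther away at most its tangent
    at 1. Both are dominated by the affine function z + lam, up to a constant
    times lam^(beta - 1): the power because beta < 1, and the tangent because it
    is at most a multiple of z above the threshold delta. *)
Lemma f_affine : exists kappa, 0 < kappa /\ forall lam z, 0 < lam <= 1 -> 0 <= z ->
  f z <= kappa * lam `^ (beta - 1) * (z + lam).
Proof.
have [C [delta [C0 d0 fC]]] := f_near0.
have f1 : 0 <= f 1 by exact: f_ge0.
have df1 : 0 < derive1 f 1 by exact: f_incr.
exists (C + (f 1 / delta + derive1 f 1)).
have A0 : 0 < f 1 / delta + derive1 f 1 by rewrite ltr_wpDl// divr_ge0// ltW.
split; first by rewrite ltr_wpDl.
move=> lam z /andP[l0 l1]; rewrite le_eqVlt => /orP[/eqP<-|z0].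
  by rewrite f_0 add0r !mulr_ge0 ?powR_ge0 ?ltW// ltr_wpDl.
have lb : 1 <= lam `^ (beta - 1).
  rewrite -opprB powRN invf_ge1 ?powR_gt0//.
  have h : lam `^ (1 - beta) <= 1 `^ (1 - beta).
    by apply: ge0_ler_powR; rewrite ?nnegrE ?subr_ge0 ?ler01// ltW.
  by rewrite powR1 in h.
have zl0 : 0 < z + lam by rewrite addr_gt0.
have [zd|dz] := ltP z delta.
  apply: (@le_trans _ _ (C * z `^ beta)); first by apply: fC; rewrite z0.
  apply: (@le_trans _ _ (C * (lam `^ (beta - 1) * (z + lam)))).
    by apply: ler_wpM2l => //; exact: powR_affine.
  rewrite -mulrA ler_wpM2r ?lerDl ?(ltW A0)//.
  by rewrite mulr_ge0 ?ltW// (lt_le_trans ltr01).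
have fz : f z <= f 1 + derive1 f 1 * z.
  have [z1|z1] := leP z 1.
    have h1 : f z <= f 1 by apply: f_le1; rewrite z0.
    by have := mulr_gt0 df1 z0; lra.
  by apply: le_trans (f_tangent z1) _; rewrite lerD2l ler_pM2l// gerBl.
have : f 1 <= f 1 / delta * z.
  by rewrite mulrAC ler_pdivlMr// ler_wpM2l.
set A := f 1 / delta in A0 *; set B := derive1 f 1 in A0 fz df1 * => fA.
have h1 : f z <= (A + B) * z by lra.
apply: (le_trans h1); apply: (@le_trans _ _ ((C + (A + B)) * (z + lam))).
  by have := mulr_ge0 C0 (ltW zl0); have := mulr_gt0 A0 l0; lra.
by rewrite ler_pM2r//; apply: ler_peMr => //; apply: addr_ge0 => //; exact: ltW.
Qed.

End growth.

(** * The weight along one branch *)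

Section branch_bound.
Context {R : realType}.
Variables (H rho : R) (f : R -> R) (c lam E : nat -> R).
Hypothesis H0 : 0 < H.
Hypothesis rho0 : 0 < rho.
Hypothesis rho1 : rho < 1.
Hypothesis f_ge0 : forall z, 0 <= z -> 0 <= f z.
Hypothesis c_ge0 : forall n, 0 <= c n.
Hypothesis lam_gt0 : forall n, 0 < lam n.
Hypothesis lam_noninc : forall n m, (n <= m)%N -> lam m <= lam n.
Hypothesis f_affine : forall n z, 0 <= z -> f z <= c n * (z + lam n).
Hypothesis E_ge1 : forall n, 1 <= E n.
Hypothesis E_rec : forall n, E n = expR (2 * (c n * step H rho n)) * E n.+1.
Local Notation node := (node H rho).
Local Notation total := (total H rho).
Local Notation step := (step H rho).

Variables (a b wbar : R) (m w : R -> R).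
Hypothesis m_ge0 : forall s, a < s <= b -> 0 <= m s.
Hypothesis m_noninc : forall s t, a < s -> s <= t -> t <= b -> m t <= m s.
Hypothesis w_eq : weight_eq f a b m wbar w.

(** Unlike the weight, its excess over the flux varies continuously, so that
    intervals can be put end to end. *)
Let u t := w t - m t.

Let w_ge0 t : a < t <= b -> 0 <= w t.
Proof. by move=> /w_eq[]. Qed.

Let fw_int t r : a < t -> t <= r -> r <= b ->
  lebesgue_measure.-integrable `[t, r] (EFin \o (f \o w)).
Proof.
move=> at_ tr rb; have [|_ I _] := @w_eq t; first by rewrite at_ (le_trans tr).
apply: integrableS I => //.
by move=> s /=; rewrite !in_itv/= => /andP[-> sr]; rewrite (le_trans sr).
Qed.

Lemma excess_split t r : a < t -> t <= r -> r <= b ->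
  u t = (\int[lebesgue_measure]_(s in `[t, r]) f (w s))%R + u r.
Proof.
move=> at_ tr rb; have tb := le_trans tr rb.
have [|_ It Et] := @w_eq t; first by rewrite at_ tb.
have [|_ Ir Er] := @w_eq r; first by rewrite (lt_le_trans at_ tr) rb.
have := @Rintegral_itvB R (f \o w) (BLeft t) (BRight b) r It.
rewrite !bnd_simp => /(_ tr rb) /eqP; rewrite subr_eq => /eqP S.
have S2 : \int[lebesgue_measure]_(x in `]r, b]) (f \o w) x =
    \int[lebesgue_measure]_(x in `[r, b]) (f \o w) x.
  apply: Rintegral_itv_obnd_cbnd; apply: integrableS Ir => //.
  by move=> s /=; rewrite !in_itv/= => /andP[/ltW -> ->].
rewrite /u Et Er; rewrite S2 in S.
have -> : \int[lebesgue_measure]_(s in `[t, b]) f (w s) =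
  \int[lebesgue_measure]_(s in `[r, b]) f (w s) +
  \int[lebesgue_measure]_(s in `[t, r]) f (w s) by exact: S.
ring.
Qed.

Lemma fw_integral_ge0 t r : a < t -> r <= b ->
  0 <= \int[lebesgue_measure]_(s in `[t, r]) f (w s).
Proof.
move=> at_ rb; apply: Rintegral_ge0 => s /=; rewrite in_itv/= => /andP[ts sr].
by apply/f_ge0/w_ge0; rewrite (lt_le_trans at_ ts) (le_trans sr rb).
Qed.

Lemma excess_noninc t r : a < t -> t <= r -> r <= b -> u r <= u t.
Proof.
by move=> at_ tr rb; rewrite (excess_split at_ tr rb) lerDr fw_integral_ge0.
Qed.

Lemma excess_end t : a < t <= b -> u b = wbar.
Proof.
move=> /andP[at_ tb]; have [|_ _ Eb] := @w_eq b; first by rewrite (lt_le_trans at_ tb) lexx.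
by rewrite /u Eb set_itv1 Rintegral_set1 add0r addrAC subrr add0r.
Qed.

Lemma fw_integral_le t r X : a < t -> t <= r -> r <= b ->
  (forall s, t <= s <= r -> f (w s) <= X) ->
  \int[lebesgue_measure]_(s in `[t, r]) f (w s) <= X * (r - t).
Proof.
move=> at_ tr rb fX.
have mtr : lebesgue_measure (`[t, r] : set R) = (r - t)%:E.
  rewrite lebesgue_measure_itv/= lte_fin; case: ltP => rt; first by rewrite -EFinB.
  by rewrite (_ : r = t) ?subrr//; apply/eqP; rewrite eq_le tr rt.
apply: (@le_trans _ _ (\int[lebesgue_measure]_(s in `[t, r]) (cst X) s)); last first.
  by rewrite Rintegral_cst//= [X in fine X]mtr.
apply: le_Rintegral => //; first exact: fw_int.
  apply: measurable_bounded_integrable => //; first by rewrite [X in (X < _)%E]mtr ltry.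
  by exists `|X|; split => [|B XB s _]; [exact: num_real|exact: ltW].
Qed.

(** On [t, r] both the flux and the excess are at most their values at t, so f(w)
    is at most c n * (u t + K) there. *)
Lemma gronwall_step n t r K : a < t -> t <= r -> r <= b -> m t + lam n <= K ->
  (u t + K) * (1 - c n * (r - t)) <= u r + K.
Proof.
move=> at_ tr rb mK.
have h : \int[lebesgue_measure]_(s in `[t, r]) f (w s) <= c n * (u t + K) * (r - t).
  apply: fw_integral_le => // s /andP[ts sr].
  have sb : a < s <= b by rewrite (lt_le_trans at_ ts) (le_trans sr rb).
  apply: (le_trans (f_affine n (w_ge0 sb))); apply: ler_wpM2l => //.
  have := excess_noninc at_ ts (le_trans sr rb).
  have := m_noninc at_ ts (le_trans sr rb); rewrite /u; lra.
rewrite (excess_split at_ tr rb) in h *; lra.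
Qed.

Lemma inv_le_expR (x : R) : 0 <= x <= 2^-1 -> 1 <= expR (2 * x) * (1 - x).
Proof.
move=> /andP[x0 x1]; have h := expR_ge1Dx (2 * x).
apply: (@le_trans _ _ ((1 + 2 * x) * (1 - x))); first nra.
by rewrite ler_wpM2r//; lra.
Qed.

(** Gronwall's inequality. On an interval with c n * (r - t) <= 1/2 it follows from
    the previous step; longer intervals are bisected. *)
Lemma gronwall n t r K : a < t -> t <= r -> r <= b -> m t + lam n <= K ->
  u t + K <= expR (2 * (c n * (r - t))) * (u r + K).
Proof.
move=> at_ tr rb mK.
have [N hN] : exists N, c n * (r - t) <= 2 ^+ N * 2^-1.
  have x0 : 0 <= c n * (r - t) by apply: mulr_ge0 => //; rewrite subr_ge0.
  exists (Num.bound (c n * (r - t))).+1; rewrite exprS mulrAC divff ?pnatr_eq0// mul1r.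
  apply: (le_trans (ltW (archi_boundP x0))).
  by rewrite -natrX ler_nat ltnW// ltn_expl.
elim: N t r at_ tr rb mK hN => [|N IH] t r at_ tr rb mK hN.
  have x0 : 0 <= c n * (r - t) by apply: mulr_ge0 => //; rewrite subr_ge0.
  have h := gronwall_step at_ tr rb mK.
  have uK : 0 <= u t + K.
    have := w_ge0 (t := t); rewrite at_ (le_trans tr rb) => /(_ isT).
    by have := lam_gt0 n; rewrite /u; lra.
  have e : 1 <= expR (2 * (c n * (r - t))) * (1 - c n * (r - t)).
    by apply: inv_le_expR; rewrite x0/=; move: hN; rewrite expr0 mul1r.
  apply: (@le_trans _ _ (expR (2 * (c n * (r - t))) * ((u t + K) * (1 - c n * (r - t))))).
    by rewrite mulrCA ler_peMr.
  by rewrite ler_wpM2l// expR_ge0.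
pose s := (t + r) / 2.
have [ts sr] : t <= s /\ s <= r by rewrite /s; split; lra.
have h1 : c n * (s - t) <= 2 ^+ N * 2^-1 by move: hN; rewrite exprS /s; lra.
have h2 : c n * (r - s) <= 2 ^+ N * 2^-1 by move: hN; rewrite exprS /s; lra.
have mK' : m s + lam n <= K by have := m_noninc at_ ts (le_trans sr rb); lra.
have g1 := IH _ _ at_ ts (le_trans sr rb) mK h1.
have g2 := IH _ _ (lt_le_trans at_ ts) sr rb mK' h2.
apply: (le_trans g1).
rewrite (_ : 2 * (c n * (r - t)) = 2 * (c n * (s - t)) + 2 * (c n * (r - s))); last ring.
by rewrite expRD -mulrA ler_wpM2l// expR_ge0.
Qed.

Lemma E_noninc n j : (n <= j)%N -> E j <= E n.
Proof.
move=> /subnK <-; elim: (j - n)%N => // k; apply: le_trans.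
rewrite addSn [leRHS]E_rec; apply: ler_peMl; first exact: le_trans ler01 (E_ge1 _).
by rewrite -expR0 ler_expR mulr_ge0// mulr_ge0// ltW// step_gt0.
Qed.

Lemma gronwall_short n t r K : a < t -> t <= r -> r <= b ->
  node n <= t -> r <= node n.+1 -> m t + lam n <= K ->
  (u t + K) * E n.+1 <= E n * (u r + K).
Proof.
move=> at_ tr rb nt rn mK; have g := gronwall at_ tr rb mK.
have uK : 0 <= u t + K.
  have := w_ge0 (t := t); rewrite at_ (le_trans tr rb) => /(_ isT).
  by have := lam_gt0 n; rewrite /u; lra.
have urK : 0 <= u r + K.
  have := le_trans uK g; rewrite pmulr_rge0//; exact: expR_gt0.
rewrite [E n]E_rec mulrAC; apply: ler_wpM2r.
  exact: le_trans ler01 (E_ge1 _).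
apply: (le_trans g); apply: ler_wpM2r => //; rewrite ler_expR.
rewrite ler_pM2l//; apply: ler_wpM2l => //.
by have := nodeS H rho1 n; lra.
Qed.

(** The constants K that are admissible at t remain so at the later levels, since
    the flux and lam both decrease. *)
Lemma gronwall_levels n j t r K : (n <= j)%N -> a < t -> t <= r -> r <= b ->
  node n <= t -> r <= node j.+1 -> m t + lam n <= K ->
  (u t + K) * E j.+1 <= E n * (u r + K).
Proof.
move=> nj at_ tr rb nt + mK.
have mKj k : (n <= k)%N -> m t + lam k <= K by move=> /lam_noninc; lra.
have uK : 0 <= u t + K.
  have := w_ge0 (t := t); rewrite at_ (le_trans tr rb) => /(_ isT).
  by have := lam_gt0 n; rewrite /u; lra.
elim: j r nj tr rb => [|j IH] r nj tr rb rj.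
  by move: nj nt mK; rewrite leqn0 => /eqP -> nt mK; exact: gronwall_short.
have [jt|tj] := leP (node j.+1) t.
  have g := gronwall_short at_ tr rb jt rj (mKj _ nj).
  have E0 : 0 < E j.+2 by exact: lt_le_trans ltr01 (E_ge1 _).
  have urK : 0 <= u r + K.
    have : 0 <= E j.+1 * (u r + K) by apply: le_trans g; apply: mulr_ge0 => //; exact: ltW.
    by rewrite pmulr_rge0// (lt_le_trans ltr01).
  by apply: (le_trans g); apply: ler_wpM2r => //; exact: E_noninc.
have nj' : (n <= j)%N.
  by rewrite -ltnS; apply: (node_lt_inv H0 rho0 rho1); exact: le_lt_trans nt tj.
have [rj'|rj'] := leP r (node j.+1).
  apply: le_trans (IH r nj' tr rb rj'); apply: ler_wpM2l => //.
  exact: E_noninc.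
have g1 := IH _ nj' (ltW tj) (le_trans (ltW rj') rb) (lexx _).
have m' : m (node j.+1) + lam j.+1 <= K.
  have := m_noninc at_ (ltW tj) (le_trans (ltW rj') rb).
  by have := mKj _ nj; lra.
have g2 := gronwall_short (lt_trans at_ tj) (ltW rj') rb (lexx _) rj m'.
have E1 : 0 < E j.+1 by exact: lt_le_trans ltr01 (E_ge1 _).
have E2 : 0 < E j.+2 by exact: lt_le_trans ltr01 (E_ge1 _).
have En : 0 < E n by exact: lt_le_trans ltr01 (E_ge1 _).
rewrite -(ler_pM2l E1).
apply: (@le_trans _ _ (E n * (u (node j.+1) + K) * E j.+2)).
  by rewrite mulrA -[X in X <= _]/(_ * _) [E j.+1 * _]mulrC; apply: ler_wpM2r => //; exact: ltW.
by rewrite [leRHS]mulrCA -mulrA; apply: ler_wpM2l => //; exact: ltW.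
Qed.

(** With K = m t + lam n, the sum u t + K is the left-hand side, and it is carried
    to the end of the branch, where the excess is wbar. *)
Lemma weight_le_node n j t : (n <= j)%N -> a < t <= b -> node n < t -> b <= node j.+1 ->
  wbar <= (E j.+1 - 1) * (m t + lam n) ->
  w t + lam n <= E n * (m t + lam n).
Proof.
move=> nj /andP[at_ tb] nt bj wb.
have E1 : 0 < E j.+1 by exact: lt_le_trans ltr01 (E_ge1 _).
have En : 0 < E n by exact: lt_le_trans ltr01 (E_ge1 _).
have := gronwall_levels nj at_ tb (lexx _) (ltW nt) bj (lexx _).
rewrite (@excess_end t) ?at_ ?tb// => g.
rewrite (_ : w t + lam n = u t + (m t + lam n)); last by rewrite /u; ring.
rewrite -(ler_pM2r E1); apply: (le_trans g); rewrite -mulrA; apply: ler_wpM2l.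
  exact: ltW.
lra.
Qed.

(** A branch without followers may run to the very end of a line, through
    infinitely many levels. The excess that remains after level j then tends to
    0, as the length that remains does. *)
Lemma weight_le_tip n t : a < t <= b -> node n < t <= node n.+1 -> b <= total ->
  wbar <= 0 -> w t + lam n <= E n * (m t + lam n).
Proof.
move=> atb /andP[nt tn] btot wb; have /andP[at_ tb] := atb.
have K0 : 0 <= m t + lam n by rewrite addr_ge0 ?m_ge0// ltW.
have [bt|bt] := ltP b total.
  have b0 : 0 < b by apply: lt_le_trans tb; apply: le_lt_trans nt; exact: node_ge0.
  have [j /andP[nb bj]] := node_exists H0 rho0 rho1 b0 bt.
  apply: (@weight_le_node n j) => //.
    by rewrite -ltnS; apply: (node_lt_inv H0 rho0 rho1); apply: lt_le_trans bj; exact: lt_le_trans tb.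
  by apply: (le_trans wb); rewrite mulr_ge0 ?subr_ge0.
have bE : b = total by apply/eqP; rewrite eq_le btot bt.
pose Z := c 0 * (u t + (m t + lam 0)).
have Z0 : 0 <= Z.
  apply: mulr_ge0 => //; have := w_ge0 atb; have := lam_gt0 0; rewrite /u; lra.
have En : 0 < E n by exact: lt_le_trans ltr01 (E_ge1 _).
have bound j : (n <= j)%N -> u t + (m t + lam n) <=
    E n * (m t + lam n) + E n * Z * total * rho ^+ j.+1.
  move=> nj.
  have tj : t <= node j.+1 by apply: le_trans tn _; exact: node_le.
  have jb : node j.+1 <= b by rewrite bE ltW// node_lt_total.
  have uK : 0 <= u t + (m t + lam n).
    by have := w_ge0 atb; have := lam_gt0 n; rewrite /u; lra.
  have g := gronwall_levels nj at_ tj jb (ltW nt) (lexx _) (lexx _).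
  apply: (@le_trans _ _ (E n * (u (node j.+1) + (m t + lam n)))).
    by apply: le_trans g; apply: ler_peMr.
  have -> : E n * (m t + lam n) + E n * Z * total * rho ^+ j.+1 =
      E n * (m t + lam n + Z * (total * rho ^+ j.+1)) by ring.
  apply: ler_wpM2l; first exact: ltW.
  rewrite addrC lerD2l (excess_split (lt_le_trans at_ tj) jb (lexx _)).
  rewrite (excess_end atb); apply: (@le_trans _ _ (Z * (b - node j.+1))).
    rewrite -[leRHS]addr0 lerD//; apply: fw_integral_le => //.
      exact: lt_le_trans at_ tj.
    move=> s /andP[js sb]; have ts := le_trans tj js.
    have sb' : a < s <= b by rewrite (lt_le_trans at_ ts).
    apply: (le_trans (f_affine 0 (w_ge0 sb'))); apply: ler_wpM2l => //.
    have := excess_noninc at_ ts sb; have := m_noninc at_ ts sb; rewrite /u; lra.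
  by rewrite bE total_sub_node.
rewrite (_ : w t + lam n = u t + (m t + lam n)); last by rewrite /u; ring.
rewrite leNgt; apply/negP => h.
pose D := u t + (m t + lam n) - E n * (m t + lam n).
have D0 : 0 < D by rewrite subr_gt0.
pose A := E n * Z * total.
have A0 : 0 <= A.
  apply: mulr_ge0; last by rewrite ltW// total_gt0.
  by apply: mulr_ge0 => //; exact: ltW.
have : rho ^+ k @[k --> \oo] --> 0 by apply: cvg_expr; rewrite ger0_norm// ltW.
move=> /cvgr0Pnorm_lt/(_ (D / (A + 1))).
have A1 : 0 < A + 1 by rewrite ltr_wpDl.
case; first exact: divr_gt0.
move=> N _ /(_ (maxn n N).+1); rewrite /= (leq_trans (leq_maxr n N))// => /(_ isT).
have := bound _ (leq_maxl n N); rewrite -/A.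
have : 0 < rho ^+ (maxn n N).+1 by exact: exprn_gt0.
set r := rho ^+ _ => r0 hb; rewrite (gtr0_norm r0) (ltr_pdivlMr _ _ A1) /D => hN.
lra.
Qed.

End branch_bound.

(** * The tree of branches, and the weight bound *)

Section tree.
Context {R : realType}.
Variable d : nat.
Variables (H rho M : R) (mass : seq bool -> R).
Hypothesis H0 : 0 < H.
Hypothesis rho0 : 0 < rho.
Hypothesis rho1 : rho < 1.
Variable eps : R.
Hypothesis eps0 : 0 < eps.
Local Notation line := (line d H rho).
Local Notation node := (node H rho).
Local Notation total := (total H rho).
Local Notation chi := (plan d H rho mass).
Local Notation maximal_good := (maximal_good M chi eps).
Local Notation nodes := (nodes M chi eps).
Local Notation consecutive := (consecutive M chi eps).
Local Notation split_time := (@split_time R d.+1).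
Implicit Types (p q : rpath R d.+1) (beta : nat -> bool) (a b c s t r : R).

Definition follows p beta : Prop :=
  0 <= len p <= total /\ forall r, 0 <= r <= len p -> crv p r = line beta r.

Lemma maximal_follows p : maximal_good p -> exists theta, follows p (code mass theta).
Proof.
by move=> [gp _]; have [theta [_ lp pE]] := good_path_line H0 rho0 rho1 eps0 gp; exists theta.
Qed.

Let line_bits := @line_inj R d H rho H0 rho0 rho1.

Definition first_diff beta beta' n : Prop :=
  (forall m, (m < n)%N -> beta m = beta' m) /\ beta n <> beta' n.

Lemma first_diffC beta beta' n : first_diff beta beta' n -> first_diff beta' beta n.
Proof. by move=> [E D]; split => [m mn|]; [rewrite E|apply: nesym]. Qed.

Lemma split_time_first_diff p q beta beta' n : follows p beta -> follows q beta' ->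
  first_diff beta beta' n -> node n < len p -> node n < len q ->
  split_time p q = node n.
Proof.
move=> [/andP[p0 pt] pE] [/andP[q0 qt] qE] [E D] np nq.
have n0 := node_ge0 H0 rho0 rho1 n.
apply/eqP; rewrite eq_le; apply/andP; split.
  apply: ge_sup.
    by exists 0; split => // s /andP[s0 s1]; rewrite pE ?qE ?line_le0 ?s0 ?(le_trans s1).
  move=> t [t0 tp tq tE]; rewrite leNgt; apply/negP => nt; apply: D.
  apply: (line_bits nt _ (leqnn n)) => r /andP[r0 rt].
  by rewrite -pE -?qE ?tE ?r0 ?(le_trans rt).
apply: ub_le_sup.
  by exists (len p) => t [].
split; [exact: n0|exact: ltW|exact: ltW|move=> s /andP[s0 sn]].
rewrite pE ?qE ?s0 ?(le_trans sn) ?ltW//.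
exact: (eq_line _ H0 rho0 rho1 sn E).
Qed.

(** Two maximal paths that agree on their common interval of definition would be
    equal, as the longer one extends the other. *)
Lemma maximal_first_diff p q beta beta' : maximal_good p -> maximal_good q -> p <> q ->
  follows p beta -> follows q beta' ->
  exists n, [/\ first_diff beta beta' n, node n < len p & node n < len q].
Proof.
move=> mp mq pq fp fq.
have [s [s0 sp sq sD]] : exists s, [/\ 0 <= s, s <= len p, s <= len q & crv p s <> crv q s].
  apply: contrapT => /forallNP nD.
  have E s : 0 <= s -> s <= len p -> s <= len q -> crv p s = crv q s.
    by move=> s0 sp sq; apply: contrapT => sD; apply: (nD s).
  have [pq_le|qp_le] := leP (len p) (len q).
    apply: pq; apply/esym; apply: mp.2 => //; first by case: mq.
    by split => // s /andP[s0 sp]; apply: E => //; exact: le_trans pq_le.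
  apply: pq; apply: mq.2; first by case: mp.
  split; first exact: ltW.
  by move=> s /andP[s0 sq]; apply/esym/E => //; exact: le_trans (ltW qp_le).
move: (fp) (fq) => [/andP[p0 pt] pE] [/andP[q0 qt] qE].
have {}sD : line beta s <> line beta' s by rewrite -pE ?s0// -qE ?s0.
have [k [kD ks]] : exists k, beta k != beta' k /\ node k < s.
  apply: contrapT => /forallNP nD.
  have E k : node k < s -> beta k = beta' k.
    by move=> ks; apply/eqP; apply: contrapT => /negP kD; apply: (nD k).
  apply: sD; have [st|ts] := ltP s total.
    have [sle0|sgt0] := leP s 0; first by rewrite !line_le0.
    have [n /andP[n1 n2]] := node_exists H0 rho0 rho1 sgt0 st.
    apply: (eq_line _ H0 rho0 rho1 n2) => m mn; apply: E; apply: le_lt_trans n1.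
    by apply: node_le.
  congr (line _ s); apply/funext => k; apply: E; apply: lt_le_trans ts.
  exact: node_lt_total.
have exD : exists k, beta k != beta' k by exists k.
exists (ex_minn exD); case: ex_minnP => n nD nmin.
have ns : node n < s by apply: le_lt_trans ks; apply: node_le => //; exact: nmin.
split; [split; last exact/eqP|exact: lt_le_trans ns sp|exact: lt_le_trans ns sq].
by move=> m mn; apply/eqP; apply: contraLR mn => /nmin; rewrite -leqNgt.
Qed.

Lemma node_inside p b : maximal_good p -> nodes p b -> 0 < b < len p ->
  exists n, b = node n.+1.
Proof.
move=> mp [[->|->]|[q [mq qp] <-]] /andP[]; rewrite ?ltxx// => b0 _.
have [theta fp] := maximal_follows mp; have [theta' fq] := maximal_follows mq.
have [n [D np nq]] := maximal_first_diff mp mq (nesym qp) fp fq.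
move: b0; rewrite (split_time_first_diff fp fq D np nq).
by case: n {D np nq} => [|n]; [rewrite node0 ltxx|exists n].
Qed.

Lemma nodes_bounds p b : maximal_good p -> nodes p b -> 0 <= b <= len p.
Proof.
move=> mp; have [theta fp] := maximal_follows mp; have [/andP[l0 _] _] := fp.
move=> [[->|->]|[q [mq qp] <-]]; rewrite ?lexx ?l0//.
have [theta' fq] := maximal_follows mq.
have [n [D np nq]] := maximal_first_diff mp mq (nesym qp) fp fq.
by rewrite (split_time_first_diff fp fq D np nq) (ltW np) node_ge0.
Qed.

(** The paths form a tree: a path that leaves p' before p and p' separate leaves
    p at the same place. *)
Lemma node_transfer p p' beta beta' N c : maximal_good p -> maximal_good p' ->
  follows p beta -> follows p' beta' -> first_diff beta beta' N ->
  node N < len p -> node N < len p' ->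
  nodes p' c -> 0 < c -> c < node N -> nodes p c.
Proof.
move=> mp mp' fp fp' D Np Np' [[->|->]|[q [mq qp'] <-]]; rewrite ?ltxx//.
  by move=> _ /(lt_trans Np'); rewrite ltxx.
have [theta fq] := maximal_follows mq.
have [k [Dk kp' kq]] := maximal_first_diff mp' mq (nesym qp') fp' fq.
rewrite (split_time_first_diff fp' fq Dk kp' kq) => _ kN.
have kN' := node_lt_inv H0 rho0 rho1 kN.
have Dpq : first_diff beta (code mass theta) k.
  split => [m mk|]; first by rewrite D.1 ?Dk.1// (ltn_trans mk).
  by rewrite D.1//; exact: Dk.2.
right; exists q; last by rewrite (split_time_first_diff fp fq Dpq (lt_trans kN Np) kq).
split => // qp; rewrite -qp in fp.
apply: Dpq.2; apply: (line_bits kq _ (leqnn k)) => r rq.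
by rewrite -fp.2// -fq.2.
Qed.

(** A branch is followed by at most two others, one for each value of the next
    bit. When the bits agree, the two paths separate after the start of the next
    edge, and up to that point they have the same nodes. *)
Lemma follower_unique p p' beta beta' a a' b b' c c' n :
  maximal_good p -> maximal_good p' -> follows p beta -> follows p' beta' ->
  consecutive p a b -> consecutive p' a' b' -> piece p a b = piece p' a' b' ->
  consecutive p b c -> consecutive p' b' c' -> b = node n.+1 -> beta n.+1 = beta' n.+1 ->
  piece p b c = piece p' b' c'.
Proof.
move=> mp mp' fp fp' ab ab' E bc bc' bn bit.
have [aE bE] : a = a' /\ b = b' by case: E.
subst a' b'.
have Ecrv s : 0 <= s <= b -> crv p s = crv p' s.
  move=> /andP[s0 sb]; case: E => /(congr1 (fun g => g s)).
  by rewrite (min_idPl sb) (max_idPr s0).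
have bp : b <= len p by case: bc => /(nodes_bounds mp)/andP[].
have bp' : b <= len p' by case: bc' => /(nodes_bounds mp')/andP[].
have bits m : (m <= n)%N -> beta m = beta' m.
  apply: (line_bits (s := b)); first by rewrite bn; exact: node_lt.
  by move=> r /andP[r0 rb]; rewrite -fp.2 ?r0 ?(le_trans rb)// -fp'.2 ?r0 ?(le_trans rb)// Ecrv ?r0.
have b0 : 0 < b by rewrite bn -(node0 H rho); exact: node_lt.
have [pp'|pp'] := pselect (p = p').
  subst p'; congr piece.
  case: bc => _ nc bc c_next; case: bc' => _ nc' bc' c'_next.
  apply/eqP; rewrite eq_le; apply/andP; split; rewrite leNgt; apply/negP => cc.
    by apply: (c_next _ nc'); rewrite bc' cc.
  by apply: (c'_next _ nc); rewrite bc cc.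
have [N [D Np Np']] := maximal_first_diff mp mp' pp' fp fp'.
have nN : (n.+1 < N)%N.
  rewrite ltnNge; apply/negP; rewrite leq_eqVlt => /orP[/eqP NE|Nn].
    by apply: D.2; rewrite NE.
  by apply: D.2; exact: bits.
have bN : b < node N by rewrite bn; exact: node_lt.
have Tp : nodes p (node N).
  right; exists p'; last exact: (split_time_first_diff fp fp' D).
  by split => //; exact: nesym.
have Tp' : nodes p' (node N).
  by right; exists p => //; apply: (split_time_first_diff fp' fp (first_diffC D)).
have [_ nc b_c c_next] := bc; have [_ nc' b_c' c'_next] := bc'.
have cN : c <= node N by rewrite leNgt; apply/negP => h; apply: (c_next _ Tp); rewrite bN.
have cN' : c' <= node N by rewrite leNgt; apply/negP => h; apply: (c'_next _ Tp'); rewrite bN.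
have cc' : c = c'.
  apply/eqP; rewrite eq_le; apply/andP; split; rewrite leNgt; apply/negP => cc.
    apply: (c_next c'); rewrite ?b_c'//; apply: (node_transfer mp mp' fp fp' D) => //.
      exact: lt_trans b_c'.
    exact: lt_le_trans cc cN.
  apply: (c'_next c); rewrite ?b_c//.
  apply: (node_transfer mp' mp fp' fp (first_diffC D)) => //; first exact: lt_trans b_c.
  exact: lt_le_trans cc cN'.
subst c'; rewrite /piece /initial; congr (Branch _ (Path _ _)); apply/funext => s.
have c0 : 0 <= c by rewrite ltW// (lt_trans b0).
set v := Num.max _ _; have /andP[v0 vc] : 0 <= v <= c.
  by rewrite /v le_max lexx/= ge_max c0 ge_min lexx orbT.
have cp := le_trans cN (ltW Np); have cp' := le_trans cN (ltW Np').
rewrite fp.2 ?v0 ?(le_trans vc)// fp'.2 ?v0 ?(le_trans vc)//.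
exact: (eq_line _ H0 rho0 rho1 (le_trans vc cN) D.1).
Qed.

End tree.

Lemma right_lim_cst (R : realType) (g : R -> R) (a b X : R) : a < b ->
  (forall t, a < t <= b -> g t = X) -> right_lim g a = X.
Proof.
move=> ab gX; rewrite /right_lim; apply: norm_lim_near_cst; near=> t.
apply: gX; apply/andP; split; first by near: t; exact: nbhs_right_gt.
by near: t; exact: nbhs_right_le.
Unshelve. all: by end_near. Qed.

(** A right limit that does not exist is 0, hence the condition on X. *)
Lemma right_lim_le (R : realType) (g : R -> R) (a b X : R) : a < b -> 0 <= X ->
  (forall t, a < t <= b -> g t <= X) -> right_lim g a <= X.
Proof.
move=> ab X0 gX; rewrite /right_lim; have [cg|ncg] := pselect (cvg (g t @[t --> a^'+])).
  apply: limr_le => //; near=> t.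
  apply: gX; apply/andP; split; first by near: t; exact: nbhs_right_gt.
  by near: t; exact: nbhs_right_le.
by rewrite dvgP.
Unshelve. all: by end_near. Qed.

Lemma subsingleton_set (T : Type) (A : set T) :
  (forall x y, A x -> A y -> x = y) -> A = set0 \/ exists x, A = [set x].
Proof.
move=> A1; have [->|/set0P[x Ax]] := eqVneq A set0; [by left|right; exists x].
by apply/seteqP; split => [y Ay|_ ->//]; exact: A1.
Qed.

(** This bounds the excess at a node, where the next bit separates the followers.
    The two sums may have one term in common for the two bits, which is then
    counted once. *)
Lemma sum_bit_le (R : realType) (T : choiceType) (O : set T) (P : bool -> set T)
    (A B : T -> R) (G : bool -> R) :
  O = P true `|` P false -> (forall x, 0 <= G x) ->
  (forall x y z, P x y -> P x z -> y = z) ->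
  (forall x y, P x y -> A y - B y <= G x) ->
  \sum_(j \in O) A j - \sum_(j \in O) B j <= G true + G false.
Proof.
move=> -> G0 P1 PG; have g0 := G0 true; have g1 := G0 false.
have one x y : P x = [set y] -> A y - B y <= G x by move=> Pxy; apply: PG; rewrite Pxy.
case: (subsingleton_set (P1 true)) => [Pt|[y Pt]];
  case: (subsingleton_set (P1 false)) => [Pf|[z Pf]]; rewrite Pt Pf ?set0U ?setU0.
- by rewrite !fsbig_set0 subrr addr_ge0.
- by rewrite !fsbig_set1; have := one _ _ Pf; lra.
- by rewrite !fsbig_set1; have := one _ _ Pt; lra.
- have [yz|yz] := pselect (y = z).
    by rewrite yz setUid !fsbig_set1; have := one _ _ Pf; lra.
  rewrite !fsbigU//=; try by move=> x [/= -> /= xz]; case: yz.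
  by rewrite !fsbig_set1; have := one _ _ Pf; have := one _ _ Pt; lra.
Qed.

Section weight_bound.
Context {R : realType}.
Variable d : nat.
Variables (H rho M : R) (mass : seq bool -> R).
Hypothesis H0 : 0 < H.
Hypothesis rho0 : 0 < rho.
Hypothesis rho1 : rho < 1.
Hypothesis mass_ge0 : forall w, 0 <= mass w.
Hypothesis mass_nil : mass [::] = M.
Hypothesis massD : forall w, mass (rcons w false) + mass (rcons w true) = mass w.
Variables (f : R -> R) (c lam E : nat -> R).
Hypothesis f_ge0 : forall z, 0 <= z -> 0 <= f z.
Hypothesis c_ge0 : forall n, 0 <= c n.
Hypothesis lam_gt0 : forall n, 0 < lam n.
Hypothesis lamS : forall n, lam n.+1 + lam n.+1 = lam n.
Hypothesis f_affine : forall n z, 0 <= z -> f z <= c n * (z + lam n).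
Hypothesis E_ge1 : forall n, 1 <= E n.
Hypothesis E_rec : forall n, E n = expR (2 * (c n * step H rho n)) * E n.+1.
Variable eps : R.
Hypothesis eps0 : 0 < eps.
Local Notation line := (line d H rho).
Local Notation node := (node H rho).
Local Notation word := (word mass).
Local Notation chi := (plan d H rho mass).
Local Notation maximal_good := (maximal_good M chi eps).
Local Notation consecutive := (consecutive M chi eps).
Local Notation followers := (followers M chi eps).
Local Notation follows := (follows H rho).
Implicit Types (p : rpath R d.+1) (a b s t r : R).

Let lam_noninc n m : (n <= m)%N -> lam m <= lam n.
Proof.
move=> /subnK <-; elim: (m - n)%N => // k; apply: le_trans.
by rewrite addSn -(lamS (k + n)) lerDr ltW.
Qed.

Lemma initial_follows p beta b r : follows p beta -> b <= len p -> 0 <= r <= b ->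
  crv (initial p b) r = line beta r.
Proof.
move=> [_ pE] bp /andP[r0 rb]; rewrite /= (min_idPl rb) (max_idPr r0) pE//.
by rewrite r0 (le_trans rb).
Qed.

Lemma branch_flux_level p theta a b n t : follows p (code mass theta) -> b <= len p ->
  node n < t <= node n.+1 -> t <= b ->
  branch_flux M chi (piece p a b) t = mass (word theta n.+1).
Proof.
move=> fp bp nt tb; have [/andP[_ pt] _] := fp.
apply: (flux_line H0 rho0 rho1 mass_ge0 mass_nil massD (le_trans bp pt) _ nt tb).
by move=> r rb; exact: initial_follows.
Qed.

(** The invariant of the backward induction: after a shift by lam, the weight is
    at most E times the flux. Several maximal paths may run through a branch,
    and the invariant holds for each of them. *)
Definition weight_bounded (k : branch R d.+1) (w : R -> R) : Prop :=
  forall p theta a b, maximal_good p -> follows p (code mass theta) ->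
    consecutive p a b -> k = piece p a b ->
  forall n t, a < t <= b -> node n < t <= node n.+1 ->
    w t + lam n <= E n * (mass (word theta n.+1) + lam n).

(** Just after the node, the flux on a follower is the mass of one half of the cell
    of the branch. The bounds on the two followers add up, because the masses of
    the two halves sum to the mass of the cell, and their shifts to lam n. *)
Lemma excess_le p theta a b n (W : branch R d.+1 -> R -> R) :
  maximal_good p -> follows p (code mass theta) -> consecutive p a b -> b = node n.+1 ->
  (forall j, followers (piece p a b) j -> weight_bounded j (W j)) ->
  excess M chi (followers (piece p a b)) W <=
    (E n.+1 - 1) * (mass (word theta n.+1) + lam n).
Proof.
move=> mp fp ab bn IH; rewrite /excess.
pose w := word theta n.+1.
pose G (x : bool) := (E n.+1 - 1) * (mass (rcons w x) + lam n.+1).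
have -> : (E n.+1 - 1) * (mass w + lam n) = G true + G false.
  by rewrite /G -(massD w) -(lamS n); ring.
pose P (x : bool) j := exists p' theta' c', [/\ maximal_good p', follows p' (code mass theta'),
   consecutive p' a b /\ piece p a b = piece p' a b, consecutive p' b c' &
   j = piece p' b c' /\ code mass theta' n.+1 = x].
have words p' theta' c' : follows p' (code mass theta') -> piece p a b = piece p' a b ->
    maximal_good p' -> consecutive p' b c' -> word theta' n.+1 = w.
  move=> fp' pp' mp' [/(nodes_bounds H0 rho0 rho1 eps0 mp')/andP[b0 bp'] _ _ _].
  have bp : b <= len p by case: ab => _ /(nodes_bounds H0 rho0 rho1 eps0 mp)/andP[].
  have nb : node n < b <= node n.+1 by rewrite bn lexx andbT; exact: node_lt.
  apply/(lines_agreeP d H0 rho0 rho1 _ _ nb) => r /andP[r0 rb].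
  rewrite -(initial_follows fp' bp') ?r0// -(initial_follows fp bp) ?r0//.
  by case: pp' => /(congr1 (fun g => g r)) /= ->.
apply: (@sum_bit_le _ _ _ P).
- apply/seteqP; split => j.
    move=> [p' [a' [b' [c' [mp' ab' bc' E1 E2]]]]].
    have [aE bE] : a = a' /\ b = b' by case: E1.
    subst a' b'; have [theta' fp'] := maximal_follows H0 rho0 rho1 eps0 mp'.
    by case bit : (code mass theta' n.+1); [left|right]; exists p', theta', c'.
  by move=> [|] [p' [theta' [c' [mp' fp' [ab' pp'] bc' [jE _]]]]]; exists p', a, b, c'.
- by move=> x; apply: mulr_ge0; [rewrite subr_ge0|apply: addr_ge0 => //; exact: ltW].
- move=> x j j' [p' [theta' [c' [mp' fp' [ab' pp'] bc' [-> bit]]]]].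
  move=> [p2 [theta2 [c2 [mp2 fp2 [ab2 pp2] bc2 [-> bit2]]]]].
  apply: (follower_unique H0 rho0 rho1 eps0 mp' mp2 fp' fp2 ab' ab2 _ bc' bc2 bn).
    by rewrite -pp' -pp2.
  by rewrite bit bit2.
- move=> x j [p' [theta' [c' [mp' fp' [ab' pp'] bc' [jE bit]]]]].
  have fj : followers (piece p a b) j by exists p', a, b, c'.
  have wE : word theta' n.+2 = rcons w x by rewrite wordS (words p' theta' c')// bit.
  have [_ nc bc _] := bc'.
  have cp' : c' <= len p' by have /andP[] := nodes_bounds H0 rho0 rho1 eps0 mp' nc.
  pose e := Num.min c' (node n.+2).
  have be : b < e by rewrite lt_min bc bn; exact: node_lt.
  have lev t : b < t <= e -> [/\ node n.+1 < t <= node n.+2, b < t <= c' & t <= c'].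
    by rewrite -bn /e le_min => /andP[-> /andP[-> ->]].
  have -> : lo j = b by rewrite jE.
  rewrite (@right_lim_cst _ (branch_flux M chi j) b e (mass (rcons w x)))//; last first.
    by move=> t /lev[h1 _ h2]; rewrite jE (branch_flux_level b fp' cp' h1 h2) wE.
  have X0 : 0 <= E n.+1 * (mass (rcons w x) + lam n.+1) - lam n.+1.
    have := mass_ge0 (rcons w x); have := lam_gt0 n.+1; have := E_ge1 n.+1; nra.
  have := @right_lim_le _ (W j) b e _ be X0.
  rewrite /G => h; have {}h : right_lim (W j) b <= E n.+1 * (mass (rcons w x) + lam n.+1) - lam n.+1.
    apply: h => t /lev[h1 h2 _].
    have := IH j fj p' theta' b c' mp' fp' bc' jE n.+1 t h2 h1.
    by rewrite wE; lra.
  lra.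
Qed.

Lemma is_weight_bounded k w : is_weight f M chi eps k w -> weight_bounded k w.
Proof.
elim=> {}k {}w W _ IH weq p theta a b mp fp ab kE n t atb nt.
have [na nb ab_lt _] := ab.
have /andP[a0 _] := nodes_bounds H0 rho0 rho1 eps0 mp na.
have /andP[b0 bp] := nodes_bounds H0 rho0 rho1 eps0 mp nb.
have [/andP[_ ptot] _] := fp.
have btot := le_trans bp ptot.
rewrite -/(hi k) kE in weq; rewrite kE in IH.
have mE : branch_flux M chi (piece p a b) t = mass (word theta n.+1).
  by apply: (branch_flux_level a fp bp nt); case/andP: atb.
rewrite -mE.
have pE r : 0 <= r <= b -> crv (initial p b) r = line (code mass theta) r.
  by move=> rb; exact: initial_follows.
have m_ge0 s : a < s <= b -> 0 <= branch_flux M chi (piece p a b) s.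
  by move=> _; apply: fine_ge0; exact: outer_measure_ge0.
have m_noninc s t' : a < s -> s <= t' -> t' <= b ->
    branch_flux M chi (piece p a b) t' <= branch_flux M chi (piece p a b) s.
  move=> as_ st tb; apply: (flux_noninc H0 rho0 rho1 mass_ge0 mass_nil massD btot pE _ st tb).
  exact: le_lt_trans as_.
have [F0|/set0P[j0 Fj0]] := eqVneq (followers (piece p a b)) set0.
  apply: (weight_le_tip H0 rho0 rho1 f_ge0 c_ge0 lam_gt0 lam_noninc f_affine E_ge1 E_rec
    m_ge0 m_noninc weq atb nt btot).
  by rewrite F0 /excess !fsbig_set0 subrr.
have [j bj] : exists j, b = node j.+1.
  case: Fj0 => p' [a' [b' [c' [mp' _ [nb' nc' bc' _] E1 _]]]].
  have bE : b = b' by case: E1.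
  subst b'; apply: (node_inside H0 rho0 rho1 eps0 mp' nb').
  have /andP[_ cp'] := nodes_bounds H0 rho0 rho1 eps0 mp' nc'.
  by rewrite (le_lt_trans a0 ab_lt) (lt_le_trans bc').
have /andP[at_ tb] := atb; have /andP[n1 n2] := nt.
have nj : (n <= j)%N.
  by rewrite -ltnS; apply: (node_lt_inv H0 rho0 rho1); rewrite -bj; exact: lt_le_trans tb.
apply: (weight_le_node H0 rho0 rho1 f_ge0 c_ge0 lam_gt0 lam_noninc f_affine E_ge1 E_rec
    m_noninc weq nj atb n1); first by rewrite bj.
apply: le_trans (excess_le mp fp ab bj IH) _.
apply: ler_wpM2l; first by rewrite subr_ge0.
rewrite mE; apply: lerD; last exact: lam_noninc.
by apply: (mass_word_le mass_ge0 massD); rewrite ltnS.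
Qed.

End weight_bound.

(** * The cost of the dyadic plan *)

Section cost.
Context {R : realType}.
Variable d : nat.
Variables (H rho M : R) (mass : seq bool -> R).
Hypothesis H0 : 0 < H.
Hypothesis rho0 : 0 < rho.
Hypothesis rho1 : rho < 1.
Hypothesis mass_ge0 : forall w, 0 <= mass w.
Hypothesis mass_nil : mass [::] = M.
Hypothesis massD : forall w, mass (rcons w false) + mass (rcons w true) = mass w.
Variables (f : R -> R) (c lam E : nat -> R).
Hypothesis f_ge0 : forall z, 0 <= z -> 0 <= f z.
Hypothesis c_ge0 : forall n, 0 <= c n.
Hypothesis lam_gt0 : forall n, 0 < lam n.
Hypothesis lamS : forall n, lam n.+1 + lam n.+1 = lam n.
Hypothesis f_affine : forall n z, 0 <= z -> f z <= c n * (z + lam n).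
Hypothesis E_ge1 : forall n, 1 <= E n.
Hypothesis E_rec : forall n, E n = expR (2 * (c n * step H rho n)) * E n.+1.
Local Notation node := (node H rho).
Local Notation total := (total H rho).
Local Notation word := (word mass).
Local Notation chi := (plan d H rho mass).
Local Notation travelled := (travelled H rho).
Implicit Types (t theta : R).

(** Where no weight is defined its value is 0, which satisfies the bound too. *)
Lemma weight_eps_bounds eps theta t n : 0 < eps -> 0 <= t ->
  node n < travelled t <= node n.+1 ->
  0 <= weight_eps f M chi eps theta t <= E n * (mass (word theta n.+1) + lam n).
Proof.
move=> eps0 t0 tn.
have B0 : 0 <= E n * (mass (word theta n.+1) + lam n).
  apply: mulr_ge0; first exact: le_trans ler01 (E_ge1 _).
  by apply: addr_ge0 => //; exact: ltW.
rewrite /weight_eps; case: ifP => _; last by rewrite lexx B0.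
case: xgetP => [w _ [p [s [mp sp E1 pw]]]|_]; last by rewrite lexx B0.
have [theta' fp] := maximal_follows H0 rho0 rho1 eps0 mp.
have [/andP[p0 ptot] pE] := fp.
have pl r : 0 <= r <= len p -> arclen (crv p) r = r.
  move=> rl; apply: (arclen_line H0 rho0 rho1 (beta := code mass theta') _ ptot rl).
  by move=> r' /andP[r'0 r'l]; apply: pE; rewrite !ltW.
have [ts lE] := (same_curve_delayed H0 rho0 rho1 (code mass theta) t0 pl sp).1 E1.
rewrite ts in tn; have /andP[n1 n2] := tn.
have s0 : 0 < s by apply: le_lt_trans n1; exact: node_ge0.
case: pw => [[s00 _]|[a [b [ab sab ->]]]]; first by rewrite s00 ltxx in s0.
rewrite /branch_weight; case: xgetP => [w' _ iw|_]; last by rewrite lexx B0.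
have wb := is_weight_bounded H0 rho0 rho1 mass_ge0 mass_nil massD f_ge0 c_ge0
  lam_gt0 lamS f_affine E_ge1 E_rec eps0 iw mp fp ab erefl sab tn.
have wE : word theta' n.+1 = word theta n.+1.
  apply/(lines_agreeP d H0 rho0 rho1 _ _ tn) => r /andP[r0 rs].
  by rewrite lE ?r0// pE// r0 (le_trans rs)//; case/andP: sp.
rewrite wE in wb; apply/andP; split; last by have := lam_gt0 n; lra.
by case: iw => W _ weq; have [] := weq s sab.
Qed.

Lemma weight_bounds theta t n : 0 <= t -> node n < travelled t <= node n.+1 ->
  (0 <= weight f M chi theta t <= (E n * (mass (word theta n.+1) + lam n))%:E)%E.
Proof.
move=> t0 tn; apply/andP; split.
  have /andP[h _] := @weight_eps_bounds 1 theta t n ltr01 t0 tn.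
  apply: (@le_trans _ _ (weight_eps f M chi 1 theta t)%:E); first by rewrite lee_fin.
  by apply: ereal_sup_ubound; exists 1 => //=.
apply: ge_ereal_sup => _ [eps /= eps0 <-]; rewrite lee_fin.
by have /andP[] := @weight_eps_bounds eps theta t n eps0 t0 tn.
Qed.

Variable alpha : R.
Hypothesis alpha01 : 0 <= alpha <= 1.

Let E_noninc n : E n <= E 0.
Proof. exact: (E_noninc H0 rho0 c_ge0 E_ge1 E_rec (leq0n n)). Qed.

(** A bound for the cost per unit of length of a particle of word w on level n. *)
Definition density (n : nat) (w : seq bool) : R :=
  E 0 `^ alpha * lam n `^ (alpha - 1) * (1 + lam n * (mass w)^-1).

Lemma density_ge0 n w : 0 <= density n w.
Proof.
rewrite /density; apply: mulr_ge0; first by apply: mulr_ge0; exact: powR_ge0.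
by apply: addr_ge0 => //; apply: mulr_ge0; [exact: ltW|rewrite invr_ge0].
Qed.

(** As alpha - 1 <= 0, the power (m + lam)^alpha is at most (m + lam) times
    lam^(alpha - 1). Where the mass m vanishes its inverse is 0. *)
Lemma power_over_mass n w :
  (E n * (mass w + lam n)) `^ alpha * (mass w)^-1 <= density n w.
Proof.
have m0 := mass_ge0 w; have l0 := lam_gt0 n; have /andP[al0 al1] := alpha01.
have ml : 0 < mass w + lam n by rewrite ltr_wpDl.
have E0 : 0 < E n by exact: lt_le_trans ltr01 (E_ge1 _).
have h1 : (E n * (mass w + lam n)) `^ alpha <=
    E 0 `^ alpha * (lam n `^ (alpha - 1) * (mass w + lam n)).
  rewrite powRM ?(ltW E0) ?(ltW ml)//; apply: ler_pM; rewrite ?powR_ge0//.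
    apply: ge0_ler_powR => //; rewrite ?nnegrE ?(ltW E0)//.
    exact: le_trans (ltW E0) (E_noninc n).
  have -> : (mass w + lam n) `^ alpha = (mass w + lam n) `^ (alpha - 1) * (mass w + lam n).
    rewrite -[X in _ * X](powRr1 (ltW ml)) -powRD ?subrK//.
    by apply/implyP => _; rewrite gt_eqF.
  apply: ler_wpM2r; first exact: ltW.
  rewrite -opprB !powRN lef_pV2 ?posrE ?powR_gt0//.
  by apply: ge0_ler_powR; rewrite ?nnegrE ?subr_ge0// ?(ltW l0) ?(ltW ml)// lerDr.
apply: (@le_trans _ _ (E 0 `^ alpha * (lam n `^ (alpha - 1) * (mass w + lam n)) * (mass w)^-1)).
  by apply: ler_wpM2r => //; rewrite invr_ge0.
rewrite /density -!mulrA; apply: ler_wpM2l; first exact: powR_ge0.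
apply: ler_wpM2l; first exact: powR_ge0.
rewrite mulrDl lerD2r; have [->|m00] := eqVneq (mass w) 0; first by rewrite mul0r.
by rewrite divff.
Qed.

Lemma integrand_le theta t n : 0 <= t -> node n < travelled t <= node n.+1 ->
  enorm (derive1 (chi theta) t) <= 1 ->
  (weight f M chi theta t `^ alpha *
    ((multiplicity M chi theta t)^-1 * enorm (derive1 (chi theta) t))%R%:E
   <= (density n (word theta n.+1))%:E)%E.
Proof.
move=> t0 tn v1; have /andP[w0 wE] := weight_bounds theta t0 tn.
have /andP[al0 al1] := alpha01.
rewrite (multiplicity_plan d H0 rho0 rho1 mass_ge0 mass_nil massD theta t0 tn).
set w := word theta n.+1 in wE *; have m0 := mass_ge0 w.
have Y0 : 0 <= E n * (mass w + lam n) by rewrite -lee_fin (le_trans w0 wE).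
apply: (@le_trans _ _ (((E n * (mass w + lam n)) `^ alpha)%:E * ((mass w)^-1)%:E)%E).
  apply: lee_pmul; rewrite ?poweR_ge0//.
  - by rewrite lee_fin mulr_ge0 ?invr_ge0 ?enorm_ge0.
  - rewrite -poweR_EFin; apply: gt0_ler_poweR => //; rewrite in_itv/= ?leey ?w0//.
    by rewrite lee_fin Y0.
  - by rewrite lee_fin -[leRHS]mulr1; apply: ler_wpM2l; rewrite ?invr_ge0.
by rewrite -EFinM lee_fin power_over_mass.
Qed.

(** The particle is on level n between the times 1 + node n and 1 + node n.+1. While
    it waits, or once it has arrived, its speed is 0. *)
Lemma inner_integral_le theta :
  (\int[lebesgue_measure]_(t in `[0%R, stop_time chi theta])
     (weight f M chi theta t `^ alpha *
      ((multiplicity M chi theta t)^-1 * enorm (derive1 (chi theta) t))%R%:E)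
   <= \sum_(0 <= n <oo) (density n (word theta n.+1) * step H rho n)%:E)%E.
Proof.
have tot0 := total_gt0 H0 rho1.
rewrite (stop_time_delayed H0 rho0 rho1 (beta := code mass theta))//.
pose J n : set R := `]1 + node n, 1 + node n.+1]%classic.
pose g t := (\sum_(0 <= n <oo) (density n (word theta n.+1) * \1_(J n) t)%:E)%E.
have mg n : measurable_fun [set: R] (fun t => (density n (word theta n.+1) * \1_(J n) t)%:E).
  apply/measurable_EFinP; apply: measurable_funM; first exact: measurable_cst.
  by apply: measurable_indic; exact: measurable_itv.
have g0 n t : (0 <= (density n (word theta n.+1) * \1_(J n) t)%:E)%E.
  by rewrite lee_fin mulr_ge0// density_ge0.
apply: (@le_trans _ _ (\int[lebesgue_measure]_(t in `[0%R, (1 + total)%R]) g t)%E).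
  have [mN N0] := delayed_corners_null H rho.
  apply: (ge0_le_integral_off (mu := lebesgue_measure) (measurable_itv _) mN N0).
  - move=> t _; apply: mule_ge0; first exact: poweR_ge0.
    rewrite lee_fin; apply: mulr_ge0; last exact: enorm_ge0.
    by rewrite invr_ge0; apply: fine_ge0; exact: outer_measure_ge0.
  - by move=> t _; apply: nneseries_ge0 => n _ _.
  - apply: measurable_funTS.
    exact: (@ge0_emeasurable_sum _ _ R setT
      (fun n t => (density n (word theta n.+1) * \1_(J n) t)%:E) xpredT).
  - move=> t tD nc; have /andP[t0 tt] : 0 <= t <= 1 + total by move: tD; rewrite /= in_itv.
    have v := delayed_speed d H0 rho0 rho1 (code mass theta) nc.
    have [t1|t1] := leP t 1.
      rewrite -/(plan d H rho mass theta) in v; rewrite v indicE memNset.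
        by rewrite mulr0 mule0 nneseries_ge0.
      by rewrite /= in_itv/= ltNge t1.
    have t2 : t < 1 + total.
      rewrite lt_neqAle tt andbT; apply/eqP => tE; apply: nc; left; right.
      by rewrite tE addrAC subrr add0r.
    have [|n tn] := @travelled_level _ H rho H0 rho0 rho1 t; first by rewrite t1.
    have v1 : enorm (derive1 (chi theta) t) <= 1.
      by rewrite -/(plan d H rho mass theta) in v; rewrite v indicE; case: (_ \in _).
    apply: (le_trans (integrand_le t0 tn v1)).
    rewrite /g (@nneseriesD1 _ _ n xpredT (fun k _ => g0 k t) isT).
    apply: (@le_trans _ _ (density n (word theta n.+1) * \1_(J n) t)%:E); last first.
      by rewrite leeDl// nneseries_ge0.
    have Jt : J n t by rewrite /J /= in_itv/=; move: tn; rewrite travelled_move; lra.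
    by rewrite indicE mem_set// mulr1.
rewrite /g integral_nneseries; [|exact: measurable_itv
  |by move=> n; apply: measurable_funTS; exact: mg|by move=> n t _; exact: g0].
apply: lee_nneseries => n *; first by apply: integral_ge0.
under eq_integral do rewrite EFinM.
rewrite ge0_integralZl_EFin//; last 2 first.
- by apply: measurable_funTS; apply/measurable_EFinP; apply: measurable_indic; exact: measurable_itv.
- exact: density_ge0.
rewrite integral_indic//; last exact: measurable_itv.
have hJ : (lebesgue_measure (J n `&` `[0%R, (1 + total)%R]) <= (step H rho n)%:E)%E.
  apply: (@le_trans _ _ (lebesgue_measure (J n))).
    apply: le_measure; rewrite ?inE; last by move=> ? [].
      by apply: measurableI; exact: measurable_itv.
    exact: measurable_itv.
  rewrite lebesgue_measure_itv/= lte_fin.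
  case: ifP => _; last by rewrite lee_fin ltW// step_gt0.
  by rewrite -EFinB lee_fin (nodeS H rho1 n); lra.
rewrite [X in (_ <= X)%E]EFinM; apply: lee_wpmul2l; last exact: hJ.
by rewrite lee_fin density_ge0.
Qed.

(** Each of the 2^(n + 1) words of level n contributes its mass plus at most
    lam n. *)
Lemma density_integral n :
  (\int[completed_lebesgue_measure]_(theta in [set theta : R | (0 <= theta <= M)%R])
     (density n (word theta n.+1))%:E
   <= (E 0 `^ alpha * lam n `^ (alpha - 1) * (M + lam n * 2 ^+ n.+1))%:E)%E.
Proof.
pose dom : set R := [set theta : R | 0 <= theta <= M].
have mdom : @measurable _ (lebesgueTypeR R) dom := dom_measurable M.
have cyl w := cylinder_measurable mass_ge0 mass_nil massD n.+1 w.
rewrite (@integral_words _ (lebesgueTypeR R) _ completed_lebesgue_measure dom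
  (fun theta => word theta n.+1) n.+1 mdom (fun theta _ => size_word mass theta n.+1)
  cyl (density n) (density_ge0 n)).
have sumM : \sum_(t : n.+1.-tuple bool) mass t = M.
  apply: EFin_inj; rewrite -sumEFin.
  have := word_set_measure mass_ge0 mass_nil massD n.+1 setT.
  rewrite (_ : _ `&` _ = [set theta | 0 <= theta <= M /\ word theta 0 = [::]]); last first.
    by apply/seteqP; split => theta [].
  rewrite (word_measure mass_ge0 mass_nil massD (w := [::]))// mass_nil => ->.
  by apply: eq_bigr => t _; rewrite asboolT// mul1e.
rewrite (eq_bigr (fun t : n.+1.-tuple bool => (density n t * mass t)%:E)); last first.
  move=> t _; rewrite [RHS]EFinM; congr (_ * _)%E.
  exact: (cylinder_measure mass_ge0 mass_nil massD (size_tuple t)).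
rewrite sumEFin lee_fin.
have A0 : 0 <= E 0 `^ alpha * lam n `^ (alpha - 1) by apply: mulr_ge0; exact: powR_ge0.
apply: (@le_trans _ _ (\sum_(t : n.+1.-tuple bool)
    E 0 `^ alpha * lam n `^ (alpha - 1) * (mass t + lam n))).
  apply: ler_sum => t _; rewrite /density -mulrA; apply: ler_wpM2l => //.
  rewrite mulrDl mul1r lerD2l -mulrA; apply: ler_piMr; first exact: ltW.
  by have [->|m0] := eqVneq (mass t) 0; rewrite ?mulr0// mulVf.
rewrite -mulr_sumr big_split/= sumM; apply: ler_wpM2l => //; rewrite lerD2l.
by rewrite sumr_const card_tuple card_bool -natrX mulr_natr.
Qed.

Lemma plan_cost_le :
  (plan_cost f M chi alpha <= \sum_(0 <= n <oo)
    (E 0 `^ alpha * lam n `^ (alpha - 1) * (M + lam n * 2 ^+ n.+1) * step H rho n)%:E)%E.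
Proof.
pose dom : set R := [set theta : R | 0 <= theta <= M].
have mdom : @measurable _ (lebesgueTypeR R) dom := dom_measurable M.
have dE : `[0, M]%classic = dom by apply/seteqP; split => x; rewrite /= in_itv.
have s0 n := ltW (step_gt0 H0 rho0 n).
rewrite /plan_cost dE.
apply: (@le_trans _ _ (\int[completed_lebesgue_measure]_(theta in dom)
    \sum_(0 <= n <oo) (density n (word theta n.+1) * step H rho n)%:E)%E).
  apply: ge0_le_integral_nm => theta _; last exact: inner_integral_le.
  apply: integral_ge0 => t _; apply: mule_ge0; first exact: poweR_ge0.
  rewrite lee_fin; apply: mulr_ge0; last exact: enorm_ge0.
  by rewrite invr_ge0; apply: fine_ge0; exact: outer_measure_ge0.
have md n : @measurable_fun _ _ (lebesgueTypeR R) _ dom (fun theta => (density n (word theta n.+1))%:E).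
  exact: (@measurable_fun_words _ (lebesgueTypeR R) R dom (fun theta => word theta n.+1) n.+1
    (fun theta _ => size_word mass theta n.+1)
    (fun w => cylinder_measurable mass_ge0 mass_nil massD n.+1 w) (density n)).
rewrite (@integral_nneseries _ (lebesgueTypeR R) R completed_lebesgue_measure dom mdom
  (fun n theta => (density n (word theta n.+1) * step H rho n)%:E)).
- apply: lee_nneseries => n *.
    by apply: integral_ge0 => theta _; rewrite lee_fin mulr_ge0// density_ge0.
  under eq_integral => theta _ do rewrite mulrC EFinM.
  rewrite (@ge0_integralZl_EFin _ (lebesgueTypeR R))//; last first.
    by move=> theta _; rewrite lee_fin density_ge0.
  rewrite [X in (_ <= X)%E]EFinM muleC; apply: lee_wpmul2r; first by rewrite lee_fin.
  exact: density_integral.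
- move=> n; under eq_fun do rewrite EFinM.
  by apply: emeasurable_funM => //; exact: measurable_cst.
- by move=> n theta _; rewrite lee_fin mulr_ge0// density_ge0.
Qed.

End cost.

(** * Choice of the ratio, and the finiteness of the cost *)

Section powers_of_two.
Context {R : realType}.

Lemma powR2_lt1 (x : R) : x < 0 -> 2 `^ x < 1.
Proof.
move=> x0; rewrite /powR pnatr_eq0/= expR_lt1 nmulr_rlt0// ln_gt0//.
by rewrite (ltr_nat R 1 2).
Qed.

Lemma powR_halves n (x : R) : (2^-1 ^+ n) `^ (x - 1) = (2 `^ (1 - x)) ^+ n.
Proof.
have two0 : (0 : R) <= 2 by [].
have h : (2^-1 : R) = 2 `^ (-1) by rewrite powRN powRr1.
have hn : (2^-1 : R) ^+ n = 2 `^ (- n%:R).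
  by rewrite h -(powR_mulrn n (powR_ge0 _ _)) -powRrM mulN1r.
rewrite hn -(powR_mulrn n (powR_ge0 2 (1 - x))) -powRrM -powRrM; congr (_ `^ _).
by rewrite mulNr -mulrN opprB mulrC.
Qed.

End powers_of_two.

Lemma geometric_nneseries_lty (R : realType) (C q : R) : 0 <= C -> 0 < q < 1 ->
  (\sum_(0 <= n <oo) (C * q ^+ n)%:E < +oo)%E.
Proof.
move=> C0 /andP[q0 q1].
apply: (@le_lt_trans _ _ (C / (1 - q))%:E); last exact: ltry.
apply: lime_le.
  by apply: is_cvg_nneseries => n _ _; rewrite lee_fin mulr_ge0// exprn_ge0 ?ltW.
near=> N; rewrite sumEFin lee_fin.
by have := @geometric_le_lim R N C q C0 q0; rewrite ger0_norm ?(ltW q0)//; apply.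
Unshelve. all: by end_near. Qed.

Theorem theorem3p3 (R : realType) (d : nat)
    (mu : {measure set (borel_rV R d) -> \bar R})
    (M L alpha beta : R) (f : R -> R) :
  (0 < d)%N ->
  0 < M -> mu setT = M%:E ->
  0 < L -> mu (~` cube L) = 0%E ->
  0 <= alpha <= 1 -> 1 - d%:R^-1 < alpha ->
  (forall z, 0 <= z -> 0 <= f z) ->
  {within `[0, +oo[, continuous f} ->
  (forall z, 0 < z ->
     [/\ derivable f z 1, derivable (derive1 f) z 1 &
         {for z, continuous (derive1n 2 f)}]) ->
  f 0 = 0 ->
  (forall z, 0 < z -> 0 < derive1 f z) ->
  (forall z, 0 < z -> derive1n 2 f z <= 0) ->
  1 - d%:R^-1 < beta < 1 ->
  (limf_esup (fun z : R => (z `^ (- beta) * f z)%:E) (0^'+) < +oo)%E ->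
  (irrigation_cost f alpha mu < +oo)%E.
Proof.
case: d mu => // d mu _ M0 muT L0 mucube alpha01 alphad f_ge0 _ f_smooth f_0 f_incr
  f_concave /andP[betad beta1] f_beta.
have dge1 : (d.+1%:R : R)^-1 <= 1 by rewrite invf_le1// ler1n.
have d0 : (0 : R) < d.+1%:R^-1 by rewrite invr_gt0.
have beta0 : 0 <= beta by apply: le_trans (ltW betad); rewrite subr_ge0.
have [kappa [kappa0 fk]] := f_affine f_ge0
  (fun z z0 => let: And3 h1 h2 _ := f_smooth z z0 in conj h1 h2) f_0 f_incr f_concave
  beta0 beta1 f_beta.
(* The steps are halved in each round of the axes. *)
pose rho : R := 2 `^ (- d.+1%:R^-1).
have rho0 : 0 < rho by exact: powR_gt0.
have rho1 : rho < 1 by apply: powR2_lt1; rewrite oppr_lt0.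
have rhod : rho ^+ d.+1 = 2^-1.
  rewrite -powR_mulrn ?(ltW rho0)// /rho -powRrM mulNr mulVf ?pnatr_eq0//.
  by rewrite powRN powRr1.
have ratio x : 1 - d.+1%:R^-1 < x -> 0 < rho * 2 `^ (1 - x) < 1.
  move=> dx; rewrite mulr_gt0 ?powR_gt0//= /rho -powRD; last first.
    by apply/implyP => _; rewrite pnatr_eq0.
  by apply: powR2_lt1; rewrite addrA [_ + 1]addrC subr_lt0.
pose lam n : R := 2^-1 ^+ n.
have lam_gt0 n : 0 < lam n by rewrite exprn_gt0// invr_gt0.
have lamS n : lam n.+1 + lam n.+1 = lam n.
  by rewrite /lam exprS; field.
have lam_le1 n : lam n <= 1.
  by apply: exprn_ile1; [rewrite invr_ge0|rewrite invf_le1// (ler_nat R 1 2)].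
pose c n := kappa * lam n `^ (beta - 1).
have c_ge0 n : 0 <= c n by apply: mulr_ge0; [exact: ltW|exact: powR_ge0].
have f_aff n z : 0 <= z -> f z <= c n * (z + lam n).
  by apply: fk; rewrite lam_gt0 lam_le1.
pose q := rho * 2 `^ (1 - beta); have /andP[q0 q1] := ratio beta betad.
pose S := kappa * L / (1 - q).
have S0 : 0 <= S.
  by apply: divr_ge0; [rewrite mulr_ge0// ltW|rewrite subr_ge0 ltW].
(* Half of the exponent is the sum of the terms c k * step k with n <= k, which
   form a geometric series. *)
pose E n := expR (2 * (S * q ^+ n)).
have E_ge1 n : 1 <= E n.
  rewrite -expR0 ler_expR; apply: mulr_ge0 => //; apply: mulr_ge0 => //.
  by rewrite exprn_ge0// ltW.
have E_rec n : E n = expR (2 * (c n * step L rho n)) * E n.+1.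
  rewrite /E -expRD; congr expR; rewrite -mulrDr; congr (2 * _).
  have -> : c n * step L rho n = kappa * L * q ^+ n.
    by rewrite /c /step /lam powR_halves /q exprMn; ring.
  rewrite /S exprS; field.
  by rewrite subr_eq0 gt_eqF.
have LH : L / 2 <= L by lra.
pose mass := cell_mass L rho mu.
have mass_ge0 w : 0 <= mass w by exact: cell_mass_ge0.
have mass_nil : mass [::] = M by exact: cell_mass_nil.
have massD w : mass (rcons w false) + mass (rcons w true) = mass w.
  exact: (cell_massD _ _ muT).
have fineM : fine (mu setT) = M by rewrite muT.
rewrite /irrigation_cost fineM.
pose chi := plan d L rho mass; apply: (@le_lt_trans _ _ (plan_cost f M chi alpha)).
  apply: ereal_inf_lbound; exists chi; last by []; split.
    exact: (plan_irrigation L0 rho0 rho1 LH rhod muT mucube).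
  exact: (plan_A2 d L0 rho0 rho1 M0 mass_ge0 mass_nil massD).
apply: le_lt_trans (plan_cost_le d L0 rho0 rho1 mass_ge0 mass_nil massD f_ge0 c_ge0
  lam_gt0 lamS f_aff E_ge1 E_rec alpha01) _.
rewrite (eq_eseriesr (g := fun n => (E 0 `^ alpha * (M + 2) * L *
    (rho * 2 `^ (1 - alpha)) ^+ n)%:E)); last first.
  move=> n _; congr EFin.
  have cells : lam n * 2 ^+ n.+1 = 2.
    by rewrite /lam exprS mulrCA -[X in 2 * X]exprMn mulVf ?pnatr_eq0// expr1n mulr1.
  by rewrite cells /lam powR_halves [in RHS]exprMn /step; ring.
apply: geometric_nneseries_lty; last exact: ratio.
apply: mulr_ge0; last exact: ltW.
by apply: mulr_ge0; [exact: powR_ge0|lra].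
Qed.
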